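(* Let $F^m=(M,M',F)$ be a Finsler manifold, $HM'$ a nonlinear connection on $M'$ with associate almost complex structure $J$, and $S,T$ two skew-symmetric Finsler tensor fields of type $(1,2)$ on $F^m$. Let $\mathcal{D}$ be the natural almost complex linear connection associated to the $(HM',S,T)$-Cartan connection $FC=(HM',\nabla)$, and let $T^{\mathcal{D}}$ be its torsion. If $T^{\mathcal{D}}=0$, then $(M',J,G)$ is a Kähler manifold, where $G$ is the Sasaki metric on $M'$.
   Context: Let $M$ be a real $m$-dimensional smooth manifold, $\pi:TM\to M$ its tangent bundle with zero section $\theta$, and $M'\subset TM$ a nonempty open submanifold with $\pi(M')=M$ and $\theta(M)\cap M'=\varnothing$, with induced local coordinates $(x^i,y^i)$. A Finsler manifold $F^m=(M,M',F)$ is given by a positive smooth function $F$ on $M'$ such that $F^{\ast}=F^2$ satisfies $F^{\ast}(x,ky)=k^2F^{\ast}(x,y)$ for $k>0$ (whenever both sides are defined) and $g_{ij}=\frac12\frac{\partial^2F^{\ast}}{\partial y^i\partial y^j}$ is positive definite at each point. $VM'=\ker(\pi_{\ast}|_{TM'})$ is the vertical vector bundle, locally spanned by $\frac{\partial}{\partial y^i}$; $g$ denotes the metric on $VM'$ with $g(\frac{\partial}{\partial y^i},\frac{\partial}{\partial y^j})=g_{ij}$. A nonlinear connection is a distribution $HM'$ with $TM'=HM'\oplus VM'$; it is locally spanned by $\frac{\delta}{\delta x^i}=\frac{\partial}{\partial x^i}-N^j_i(x,y)\frac{\partial}{\partial y^j}$. $h$ and $v$ are the projections of $TM'$ onto $HM'$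 and $VM'$. The associate almost complex structure to $HM'$ is the bundle map $J:TM'\to TM'$ with $J(\frac{\delta}{\delta x^i})=-\frac{\partial}{\partial y^i}$, $J(\frac{\partial}{\partial y^i})=\frac{\delta}{\delta x^i}$. A skew-symmetric Finsler tensor field of type $(1,2)$ is a skew-symmetric $C^\infty(M')$-bilinear map $\Gamma(VM')\times\Gamma(VM')\to\Gamma(VM')$. For a linear connection $\nabla$ on $VM'$ (covariant derivative of vertical sections along arbitrary $X\in\Gamma(TM')$), the natural almost complex linear connection associated to $(HM',\nabla)$ is the linear connection on $M'$ given by $\mathcal{D}_XY=\nabla_XvY-J\nabla_XJhY$ for $X,Y\in\Gamma(TM')$, with torsion $T^{\mathcal{D}}(X,Y)=\mathcal{D}_XY-\mathcal{D}_YX-[X,Y]$. The $(HM',S,T)$-Cartan connection is the pair $(HM',\nabla)$, where $\nabla$ is the unique linear connection on $VM'$ such that $\nabla_Xg=0$ for all $X\in\Gamma(TM')$ and, for all $X,Y\in\Gamma(TM')$, $T^{\mathcal{D}}(vX,vY)=S(vX,vY)$ and $hT^{\mathcal{D}}(hX,hY)=J\,T(JhX,JhY)$. The Sasaki metric is $G=g_{ij}(x,y)dx^idx^j+g_{ij}(x,y)\delta y^i\delta y^j$ with $\delta y^i=dy^i+N^i_j(x,y)dx^j$; that is, $G(\frac{\delta}{\delta x^i},\frac{\delta}{\delta x^j})=G(\frac{\partial}{\partial y^i},\frac{\partial}{\partial y^j})=g_{ij}$ and $G(\frac{\delta}{\delta x^i},\frac{\partial}{\partial y^j})=0$. *)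

(* Defs.v *)
From HB Require Import structures.
From mathcomp Require Import all_boot all_order all_algebra.
From mathcomp Require Import all_classical all_reals all_analysis.

Set Implicit Arguments.
Unset Strict Implicit.
Unset Printing Implicit Defensive.
Import Order.TTheory GRing.Theory Num.Theory numFieldNormedType.Exports.
Local Open Scope classical_set_scope.
Local Open Scope ring_scope.

(* Smooth maps between open sets of finite-dimensional normed spaces. *)

Fixpoint Ck (R : realType) (k : nat) (E F : normedModType R)
    (U : set E) (f : E -> F) : Prop :=
  match k with
  | 0 => forall x, U x -> {for x, continuous f}
  | k'.+1 => (forall x, U x -> differentiable f x) /\
             (forall v : E, Ck k' U ('D_v f))
  end.

Definition smooth_on (R : realType) (E F : normedModType R)
    (U : set E) (f : E -> F) : Prop := forall k, Ck k U f.

(* [charts E N] is the data of a family of charts of N modelled on E.  The map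
   [phi a] is meaningful on [dom a] only, and [psi a], its inverse, on
   [target a] only.  [chart_at p] is a preferred chart around p.  The tangent
   space at p is the model space E itself: a tangent vector at p is encoded by
   its components in the chart [chart_at p]. *)
Record charts (R : realType) (E : normedModType R) (N : Type) := Charts {
  cidx : Type ;
  dom : cidx -> set N ;
  phi : cidx -> N -> E ;
  psi : cidx -> E -> N ;
  chart_at : N -> cidx
}.

Section ChartedSpace.
Context {R : realType} {E : normedModType R} {N : Type} (c : charts E N).
Implicit Types (a : cidx c) (u : N) (X Y Z : N -> E).

Definition target a : set E := phi a @` dom a.

(* openness in the topology generated by the charts *)
Definition chart_open (A : set N) : Prop :=
  forall a, open (phi a @` (A `&` dom a)).

(* components in the chart a of a tangent vector at u, and conversely *)
Definition to_chart a u (w : E) : E :=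
  'd (phi a \o psi (chart_at c u)) (phi (chart_at c u) u) w.

Definition from_chart a u (w : E) : E :=
  'd (phi (chart_at c u) \o psi a) (phi a u) w.

Definition smooth_fun (F : normedModType R) (f : N -> F) : Prop :=
  forall a, smooth_on (target a) (f \o psi a).

Definition chart_rep a X : E -> E :=
  fun z => to_chart a (psi a z) (X (psi a z)).

(* Gamma(TN) *)
Definition smooth_field X : Prop :=
  forall a, smooth_on (target a) (chart_rep a X).

(* X f *)
Definition lie_der X (f : N -> R) : N -> R := fun u =>
  'd (f \o psi (chart_at c u)) (phi (chart_at c u) u) (X u).

(* in any chart, [X, Y]^k = X^i d_i Y^k - Y^i d_i X^k *)
Definition bracket X Y : N -> E := fun u =>
  let a := chart_at c u in
  'd (chart_rep a Y) (phi a u) (X u) - 'd (chart_rep a X) (phi a u) (Y u).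

Definition field_map (A : N -> E -> E) X : N -> E := fun u => A u (X u).

Definition nijenhuis (J : N -> E -> E) X Y : N -> E := fun u =>
  bracket (field_map J X) (field_map J Y) u - bracket X Y u
  - J u (bracket X (field_map J Y) u) - J u (bracket (field_map J X) Y u).

Definition fundamental_form (J : N -> E -> E) (G : N -> E -> E -> R) X Y :
  N -> R := fun u => G u (X u) (J u (Y u)).

(* exterior derivative of a 2-form, by Cartan's invariant formula *)
Definition dform2 (om : (N -> E) -> (N -> E) -> N -> R) X Y Z : N -> R :=
  fun u =>
    lie_der X (om Y Z) u - lie_der Y (om X Z) u + lie_der Z (om X Y) u
    - om (bracket X Y) Z u + om (bracket X Z) Y u - om (bracket Y Z) X u.

Record riemannian_metric (G : N -> E -> E -> R) : Prop := {
  riem_linear : forall u (k : R) w1 w2 w,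
    G u (k *: w1 + w2) w = k * G u w1 w + G u w2 w ;
  riem_sym : forall u w1 w2, G u w1 w2 = G u w2 w1 ;
  riem_pos : forall u w, w != 0 -> 0 < G u w w ;
  riem_smooth : forall X Y, smooth_field X -> smooth_field Y ->
    smooth_fun (fun u => G u (X u) (Y u))
}.

Record almost_complex_structure (J : N -> E -> E) : Prop := {
  acs_linear : forall u (k : R) w1 w2,
    J u (k *: w1 + w2) = k *: J u w1 + J u w2 ;
  acs_square : forall u w, J u (J u w) = - w ;
  acs_smooth : forall X, smooth_field X -> smooth_field (field_map J X)
}.

(* Hermitian metric, integrable almost complex structure (in the sense of the
   vanishing of the Nijenhuis tensor) and closed fundamental 2-form *)
Record is_kahler (J : N -> E -> E) (G : N -> E -> E -> R) : Prop := {
  kahler_acs : almost_complex_structure J ;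
  kahler_metric : riemannian_metric G ;
  kahler_hermitian : forall u w1 w2, G u (J u w1) (J u w2) = G u w1 w2 ;
  kahler_integrable : forall X Y, smooth_field X -> smooth_field Y ->
    forall u, nijenhuis J X Y u = 0 ;
  kahler_closed : forall X Y Z,
    smooth_field X -> smooth_field Y -> smooth_field Z ->
    forall u, dform2 (fundamental_form J G) X Y Z u = 0
}.

End ChartedSpace.

Record is_smooth_manifold (R : realType) (E : normedModType R)
    (M : topologicalType) (c : charts E M) : Prop := {
  mfd_hausdorff : hausdorff_space M ;
  mfd_second_countable : @second_countable M ;
  mfd_dom_open : forall a : cidx c, open (dom a) ;
  mfd_target_open : forall a : cidx c, open (target a) ;
  mfd_phiK : forall (a : cidx c) p, dom a p -> psi a (phi a p) = p ;
  mfd_phi_continuous : forall a : cidx c, {within dom a, continuous (phi a)} ;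
  mfd_psi_continuous : forall a : cidx c,
    {within target a, continuous (psi a)} ;
  mfd_transition : forall a b : cidx c,
    smooth_on (phi a @` (dom a `&` dom b)) (phi b \o psi a) ;
  mfd_chart_at : forall p, dom (chart_at c p) p
}.

(* differential of f : N1 -> N2 at u *)
Definition tangent_map (R : realType) (E1 E2 : normedModType R) (N1 N2 : Type)
    (c1 : charts E1 N1) (c2 : charts E2 N2) (f : N1 -> N2) (u : N1) :
    E1 -> E2 :=
  'd (phi (chart_at c2 (f u)) \o f \o psi (chart_at c1 u))
     (phi (chart_at c1 u) u).

(* The tangent bundle, as the set of pairs (p, v) with v a tangent vector at p
   (given by its components in [chart_at p]).  Its charts are the induced
   coordinates (x^i, y^i); its topology is the one generated by these charts,
   not the product topology of M * E. *)
Definition tangent_charts (R : realType) (E : normedModType R) (M : Type)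
    (c : charts E M) : charts (E * E)%type (M * E)%type :=
  @Charts R (E * E)%type (M * E)%type (cidx c)
    (fun a => [set q | dom a q.1])
    (fun a q => (phi a q.1, to_chart a q.1 q.2))
    (fun a z => (psi a z.1, from_chart a (psi a z.1) z.2))
    (fun q => chart_at c q.1).

(* Restriction of charts to an (open) subset A; the point u0 of A is only the
   default value of the inverse charts outside their targets. *)
Definition sub_charts (R : realType) (E : normedModType R) (N : Type)
    (c : charts E N) (A : set N) (u0 : A) : charts E A :=
  @Charts R E A (cidx c)
    (fun a => [set u | dom a (val u)])
    (fun a u => phi a (val u))
    (fun a z => insubd u0 (psi a z))
    (fun u => chart_at c (val u)).

Section Finsler.
Context {R : realType} {m : nat} {M : Type} (c : charts 'rV[R]_m M).

Local Notation E := 'rV[R]_m.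
Local Notation EE := ('rV[R]_m * 'rV[R]_m)%type.
Local Notation e_ i := (delta_mx ord0 i : 'rV[R]_m).

(* M' is an open subset of TM avoiding the zero section and projecting onto
   M. *)
Record slit_domain (M' : set (M * E)) : Prop := {
  slit_open : chart_open (tangent_charts c) M' ;
  slit_surj : forall p, exists v, M' (p, v) ;
  slit_zero : forall p, ~ M' (p, 0)
}.

Context {M' : set (M * E)} (u0 : M').

Definition slit_charts : charts EE M' := sub_charts (tangent_charts c) u0.

Local Notation c' := slit_charts.
Implicit Types (a : cidx slit_charts) (u : M') (w : EE) (X Y U W : M' -> EE).

Definition tpi u : M := (val u).1.
Definition tvec u : E := (val u).2.

(* the fundamental tensor in the chart a *)
Definition gF (F : M' -> R) a u (i j : 'I_m) : R :=
  2^-1 * 'D_((0, e_ i) : EE)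
           ('D_((0, e_ j) : EE) ((fun q => F q ^+ 2) \o psi a)) (phi a u).

Record finsler (F : M' -> R) : Prop := {
  finsler_pos : forall u, 0 < F u ;
  finsler_smooth : smooth_fun c' F ;
  finsler_homogeneous : forall (k : R) u u', 0 < k ->
    tpi u' = tpi u -> tvec u' = k *: tvec u -> F u' ^+ 2 = k ^+ 2 * F u ^+ 2 ;
  finsler_convex : forall a u (xi : E), dom a u -> xi != 0 ->
    0 < \sum_(i < m) \sum_(j < m) gF F a u i j * xi ord0 i * xi ord0 j
}.

(* VM' = ker pi_* *)
Definition VM u : {vspace EE} := lker (linfun (tangent_map c' c tpi u)).

Definition vertical_section U : Prop :=
  smooth_field c' U /\ forall u, U u \in VM u.

(* the coordinate tangent vectors and 1-forms of the chart a at u *)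
Definition pd_x a u (i : 'I_m) : EE := from_chart a u (e_ i, 0).
Definition pd_y a u (i : 'I_m) : EE := from_chart a u (0, e_ i).
Definition d_x a u (i : 'I_m) w : R := (to_chart a u w).1 ord0 i.
Definition d_y a u (i : 'I_m) w : R := (to_chart a u w).2 ord0 i.

(* the metric on VM' with g(d/dy^i, d/dy^j) = g_ij *)
Definition gV (F : M' -> R) u (w1 w2 : EE) : R :=
  let a := chart_at c' u in
  \sum_(i < m) \sum_(j < m) gF F a u i j * d_y a u i w1 * d_y a u j w2.

(* A complement of VM' in TM', locally spanned by
   delta/delta x^i = d/dx^i - N^j_i d/dy^j with N smooth; here
   [Nc z i j] is N^j_i at the point of coordinates z. *)
Record nonlinear_connection (H : M' -> {vspace EE}) : Prop := {
  nlc_direct : forall u, (H u :&: VM u = 0)%VS ;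
  nlc_full : forall u, (H u + VM u = fullv)%VS ;
  nlc_smooth : forall a, exists Nc : EE -> 'M[R]_m,
    smooth_on (target a) Nc /\
    forall u, dom a u -> H u =
      <<[seq pd_x a u i - \sum_(j < m) Nc (phi a u) i j *: pd_y a u j
        | i <- enum 'I_m]>>%VS
}.

Section Connection.
Context (H : M' -> {vspace EE}).

Definition hproj u : 'End(EE) := daddv_pi (H u) (VM u).
Definition vproj u : 'End(EE) := daddv_pi (VM u) (H u).

Definition hfield X : M' -> EE := fun u => hproj u (X u).
Definition vfield X : M' -> EE := fun u => vproj u (X u).

(* delta/delta x^i is the horizontal component of d/dx^i, and
   delta y^i = dy^i + N^i_j dx^j is dy^i composed with v. *)
Definition delta_x a u (i : 'I_m) : EE := hproj u (pd_x a u i).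
Definition delta_y a u (i : 'I_m) w : R := d_y a u i (vproj u w).

(* J (delta/delta x^i) = - d/dy^i and J (d/dy^i) = delta/delta x^i *)
Definition assocJ u w : EE :=
  let a := chart_at c' u in
  \sum_(i < m) (delta_y a u i w *: delta_x a u i - d_x a u i w *: pd_y a u i).

Definition sasaki (F : M' -> R) u (w1 w2 : EE) : R :=
  let a := chart_at c' u in
  \sum_(i < m) \sum_(j < m) gF F a u i j *
    (d_x a u i w1 * d_x a u j w2 + delta_y a u i w1 * delta_y a u j w2).

(* the natural almost complex linear connection associated to (H, nabla) *)
Definition natural_connection (nabla : (M' -> EE) -> (M' -> EE) -> M' -> EE)
    X Y : M' -> EE := fun u =>
  nabla X (vfield Y) u - assocJ u (nabla X (field_map assocJ (hfield Y)) u).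

End Connection.

Record skew_finsler_tensor (S : (M' -> EE) -> (M' -> EE) -> M' -> EE) : Prop := {
  sft_section : forall U W, vertical_section U -> vertical_section W ->
    vertical_section (S U W) ;
  sft_linearl : forall (f : M' -> R) U1 U2 W, smooth_fun c' f ->
    vertical_section U1 -> vertical_section U2 -> vertical_section W ->
    forall u, S (fun q => f q *: U1 q + U2 q) W u = f u *: S U1 W u + S U2 W u ;
  sft_linearr : forall (f : M' -> R) U W1 W2, smooth_fun c' f ->
    vertical_section U -> vertical_section W1 -> vertical_section W2 ->
    forall u, S U (fun q => f q *: W1 q + W2 q) u = f u *: S U W1 u + S U W2 u ;
  sft_skew : forall U W, vertical_section U -> vertical_section W ->
    forall u, S U W u = - S W U u
}.

(* linear connections on the vector bundle VM' *)
Record linear_connection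
    (nabla : (M' -> EE) -> (M' -> EE) -> M' -> EE) : Prop := {
  lc_section : forall X U, smooth_field c' X -> vertical_section U ->
    vertical_section (nabla X U) ;
  lc_linear : forall (f : M' -> R) X1 X2 U, smooth_fun c' f ->
    smooth_field c' X1 -> smooth_field c' X2 -> vertical_section U ->
    forall u, nabla (fun q => f q *: X1 q + X2 q) U u =
              f u *: nabla X1 U u + nabla X2 U u ;
  lc_additive : forall X U1 U2, smooth_field c' X ->
    vertical_section U1 -> vertical_section U2 ->
    forall u, nabla X (fun q => U1 q + U2 q) u = nabla X U1 u + nabla X U2 u ;
  lc_leibniz : forall (f : M' -> R) X U, smooth_fun c' f ->
    smooth_field c' X -> vertical_section U ->
    forall u, nabla X (fun q => f q *: U q) u =
              lie_der c' X f u *: U u + f u *: nabla X U u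
}.

Definition torsion (D : (M' -> EE) -> (M' -> EE) -> M' -> EE) X Y : M' -> EE :=
  fun u => D X Y u - D Y X u - bracket c' X Y u.

(* (H, nabla) is the (H, S, T)-Cartan connection of (M, M', F). *)
Record cartan_connection (F : M' -> R) (H : M' -> {vspace EE})
    (S T : (M' -> EE) -> (M' -> EE) -> M' -> EE)
    (nabla : (M' -> EE) -> (M' -> EE) -> M' -> EE) : Prop := {
  cc_linear : linear_connection nabla ;
  cc_metric : forall X U W, smooth_field c' X ->
    vertical_section U -> vertical_section W ->
    forall u, lie_der c' X (fun q => gV F q (U q) (W q)) u =
              gV F u (nabla X U u) (W u) + gV F u (U u) (nabla X W u) ;
  cc_vtorsion : forall X Y, smooth_field c' X -> smooth_field c' Y ->
    forall u, torsion (natural_connection H nabla) (vfield H X) (vfield H Y) u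
              = S (vfield H X) (vfield H Y) u ;
  cc_htorsion : forall X Y, smooth_field c' X -> smooth_field c' Y ->
    forall u, hproj H u
        (torsion (natural_connection H nabla) (hfield H X) (hfield H Y) u)
      = assocJ H u (T (field_map (assocJ H) (hfield H X))
                      (field_map (assocJ H) (hfield H Y)) u)
}.

End Finsler.

(* Main.v *)
Require Import Defs.
From HB Require Import structures.
From mathcomp Require Import all_boot all_order all_algebra.
From mathcomp Require Import all_classical all_reals all_analysis.
From mathcomp Require Import ring lra.
Import Order.TTheory GRing.Theory Num.Theory numFieldNormedType.Exports.
Local Open Scope classical_set_scope.
Local Open Scope ring_scope.
Set Implicit Arguments.
Unset Strict Implicit.
Unset Printing Implicit Defensive.

(** Write D for the natural connection and G for the Sasaki metric.  The proof
    rests on the classical fact that an almost Hermitian structure (J, G) with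
    D J = 0 and D G = 0 for a torsion-free connection D is Kaehler
    ([kahler_of_parallel]): torsion-freeness turns every bracket [X, Y] into
    D_X Y - D_Y X, after which the Nijenhuis tensor and the exterior derivative
    of the fundamental form expand into terms that cancel in pairs.

    Both tensors are parallel by construction of D.  The structure J exchanges
    the horizontal and the vertical components ([vv_assocJ], [hv_assocJ]), and
    D_X Y = nabla_X vY - J nabla_X JhY lets nabla act on the two vertical
    fields vY and JhY that encode Y; applying J to Y exchanges these two fields
    up to sign, whence D J = 0 ([natural_complex]).  In the same encoding the
    Sasaki metric is G(Y, Z) = g(vY, vZ) + g(JhY, JhZ) ([sasakiE]), so that
    D G = 0 is the metric property of nabla applied twice ([natural_metric]).

    The rest of the work is to see that J and G are smooth tensor fields.  Each
    of them is given at a point u by components in the preferred chart at u,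
    and this chart may vary with u in an arbitrary way; so one must compute
    them in every induced chart (x, y).  A change of induced coordinates is
    (x, y) |-> (f x, 'd f x y), whose differential is block triangular with
    the block 'd f x occurring twice on the diagonal ([slit_diff_fst],
    [slit_diff_vert]).  Hence the vertical space, the vertical lift of a tangent
    vector of the base and, modulo vertical vectors, its coordinate lift are
    independent of the chart, and J is given by the same formula in all charts
    ([assocJ_chart_lift], [assocJ_chart]).  Moreover the coordinate change is
    linear along the fibres, so the fibre Hessian of F^2 / 2 transforms as a
    tensor ([fibre_hessian_change]) and defines g on vertical vectors in any
    chart ([gV_chart]).  Its symmetry is the equality of mixed second
    derivatives ([derive_swap]). *)

(** * Smooth maps *)

(** The differential is chosen by an operator applied to [f], so differentiability
    has to be transported to [g] through the first-order expansion itself. *)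
Lemma near_eq_differentiable (R : realType) (E F : normedModType R)
    (f g : E -> F) (x : E) : {near x, f =1 g} ->
  differentiable f x -> differentiable g x.
Proof.
move=> fg df.
have [dfc dfo] := (diff_locallyP _ _).1 df.
have go : g \o shift x = cst (g x) + 'd f x +o_ 0 id.
  apply/eqaddoP => e e0; move/eqaddoP: dfo => /(_ _ e0).
  apply: filter_app.
  have fg' : \forall y \near (0 : E), f (y + x) = g (y + x).
    have : \forall y \near x, f y = g y by exact: fg.
    rewrite (near_shift 0) /=.
    by apply: filterS => y; rewrite /= subr0.
  near=> y.
  rewrite -![(_ + _ : _ -> _) _]/(_ + _) -![(- _ : _ -> _) _]/(- _).
  by rewrite /cst /= -(nbhs_singleton fg) (near fg' y).
have := diff_unique dfc go => gE.
by apply/diff_locallyP; rewrite gE.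
Unshelve. all: by end_near. Qed.

Lemma near_eq_diff (R : realType) (E F : normedModType R)
    (f g : E -> F) (x : E) : {near x, f =1 g} ->
  differentiable f x -> 'd f x = 'd g x :> (E -> F).
Proof.
move=> fg df; apply/funext => v.
rewrite -!deriveE ?(near_eq_derive _ fg)//.
exact: near_eq_differentiable fg df.
Qed.

Lemma line_cvg (R : realType) (E : normedModType R) (x v : E) :
  (fun h : R => h *: v + x) @ 0 --> x.
Proof.
have x0 : 0 *: v + x = x by rewrite scale0r add0r.
rewrite -[X in _ --> X]x0.
by apply: cvgD; [exact: scalel_continuous|exact: cvg_cst].
Qed.

(** A directional derivative only sees the restriction of the map to a line.
    So a composite with a map that is affine along a line can be differentiated
    in that direction without the chain rule. *)
Lemma derive_line (R : realType) (E E' F : normedModType R)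
    (f : E -> F) (g : E' -> F) (x v : E) (y w : E') :
  (\forall h \near (0 : R), f (h *: v + x) = g (h *: w + y)) ->
  'D_v f x = 'D_w g y.
Proof.
move=> fg; have fg0 : f x = g y.
  by have := nbhs_singleton fg; rewrite !scale0r !add0r.
rewrite /derive; congr (lim _).
rewrite eqEsubset; split; apply/near_eq_cvg/cvg_within;
by near=> h => /=; rewrite fg0 (near fg).
Unshelve. all: by end_near. Qed.

Section Ck.
Context {R : realType} {E : normedModType R} {U : set E} (Uo : open U).

Lemma near_eq_on (F : Type) (f g : E -> F) (x : E) :
  (forall y, U y -> f y = g y) -> U x -> {near x, f =1 g}.
Proof.
by move=> fg Ux; have := open_nbhs_nbhs (conj Uo Ux); apply: filterS.
Qed.

(** Openness of [U] is what makes [Ck k U] depend on the values on [U] only. *)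
Lemma Ck_eq (F : normedModType R) k (f g : E -> F) :
  (forall y, U y -> f y = g y) -> Ck k U f -> Ck k U g.
Proof.
elim: k f g => [|k IH] f g fg /=.
  move=> cf x Ux; have fgx := near_eq_on fg Ux.
  rewrite /prop_for /continuous_at -(fg _ Ux).
  by apply: cvg_trans (cf x Ux); apply: near_eq_cvg.
case=> df Df; split=> [x Ux|v].
  exact: near_eq_differentiable (near_eq_on fg Ux) (df x Ux).
apply: IH (Df v) => y Uy.
exact/near_eq_derive/(near_eq_on fg Uy).
Qed.

Lemma Ck_pred (F : normedModType R) k (f : E -> F) : Ck k.+1 U f -> Ck k U f.
Proof.
elim: k f => [|k IH] f /=.
  by case=> df _ x Ux; apply: differentiable_continuous; apply: df.
by case=> df Df; split=> // v; apply: IH; apply: Df.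
Qed.

Lemma Ck_cst (F : normedModType R) k (a : F) : Ck k U (cst a : E -> F).
Proof.
elim: k a => [|k IH] a /=; first by move=> x _; exact: cst_continuous.
split=> [x _|v]; first exact: differentiable_cst.
have -> : 'D_v (cst a) = cst 0 by apply/funext => x; rewrite derive_cst.
exact: IH.
Qed.

Lemma Ck_linear (F G : normedModType R) (L : {linear F -> G}) k (f : E -> F) :
  continuous L -> Ck k U f -> Ck k U (L \o f).
Proof.
move=> Lc; elim: k f => [|k IH] f /=.
  move=> cf x Ux; apply: continuous_comp; [exact: cf|exact: Lc].
case=> df Df; split=> [x Ux|v].
  apply: differentiable_comp; [exact: df|exact: linear_differentiable].
apply: Ck_eq (IH _ (Df v)) => x Ux /=.
have dL := linear_differentiable (f x) Lc.
rewrite [RHS]deriveE; last exact: differentiable_comp (df x Ux) dL.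
by rewrite diff_comp ?diff_lin //=; [rewrite deriveE //; exact: df|exact: df].
Qed.

Lemma CkD (F : normedModType R) k (f g : E -> F) :
  Ck k U f -> Ck k U g -> Ck k U (fun x => f x + g x).
Proof.
elim: k f g => [|k IH] f g /=.
  by move=> cf cg x Ux; apply: continuousD; [exact: cf|exact: cg].
move=> [df Df] [dg Dg]; split=> [x Ux|v].
  by apply: differentiableD; [exact: df|exact: dg].
apply: Ck_eq (IH _ _ (Df v) (Dg v)) => x Ux.
by rewrite [RHS]deriveD//; apply: diff_derivable; [exact: df|exact: dg].
Qed.

Lemma CkM k (f g : E -> R) :
  Ck k U f -> Ck k U g -> Ck k U (fun x => f x * g x).
Proof.
elim: k f g => [|k IH] f g.
  by move=> cf cg x Ux; apply: continuousM; [exact: cf|exact: cg].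
move=> cf cg; have [df Df] := cf; have [dg Dg] := cg; split=> [x Ux|v].
  by apply: differentiableM; [exact: df|exact: dg].
have fk := Ck_pred cf; have gk := Ck_pred cg.
apply: Ck_eq (CkD (IH _ _ fk (Dg v)) (IH _ _ gk (Df v))) => x Ux.
by rewrite [RHS]deriveM//; apply: diff_derivable; [exact: df|exact: dg].
Qed.

Lemma smooth_on_eq (F : normedModType R) (f g : E -> F) :
  (forall y, U y -> f y = g y) -> smooth_on U f -> smooth_on U g.
Proof. by move=> fg sf k; apply: Ck_eq (sf k). Qed.

Lemma smooth_on_cst (F : normedModType R) (a : F) : smooth_on U (fun _ : E => a).
Proof. by move=> k; apply: Ck_cst. Qed.

Lemma smooth_on_linear (F G : normedModType R) (L : {linear F -> G})
    (f : E -> F) : continuous L -> smooth_on U f -> smooth_on U (L \o f).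
Proof. by move=> Lc sf k; apply: Ck_linear. Qed.

Lemma smooth_onD (F : normedModType R) (f g : E -> F) :
  smooth_on U f -> smooth_on U g -> smooth_on U (fun x => f x + g x).
Proof. by move=> sf sg k; apply: CkD. Qed.

Lemma smooth_onM (f g : E -> R) :
  smooth_on U f -> smooth_on U g -> smooth_on U (fun x => f x * g x).
Proof. by move=> sf sg k; apply: CkM. Qed.

Lemma smooth_on_sum (I : Type) (r : seq I) (F : normedModType R)
    (f : I -> E -> F) :
  (forall i, smooth_on U (f i)) -> smooth_on U (fun x => \sum_(i <- r) f i x).
Proof.
move=> sf; elim: r => [|i r IH].
  by apply: smooth_on_eq (smooth_on_cst 0) => x _; rewrite big_nil.
by apply: smooth_on_eq (smooth_onD (sf i) IH) => x _; rewrite big_cons.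
Qed.

Lemma smooth_on_derive (F : normedModType R) (f : E -> F) v :
  smooth_on U f -> smooth_on U ('D_v f).
Proof. by move=> sf k; have [_] := sf k.+1; apply. Qed.

Lemma smooth_on_differentiable (F : normedModType R) (f : E -> F) x :
  smooth_on U f -> U x -> differentiable f x.
Proof. by move=> sf; have [] := sf 1%N; move=> df _; exact: df. Qed.

Lemma smooth_on_scale (F : normedModType R) (k : E -> R) (w : F) :
  smooth_on U k -> smooth_on U (fun x => k x *: w).
Proof.
move=> sk n; move: k {sk}(sk n); elim: n => [|n IH] k /=.
  by move=> ck x Ux; apply: continuousZr_tmp; exact: ck.
case=> dk Dk; split=> [x Ux|v]; first by apply: differentiableZl; exact: dk.
apply: Ck_eq (IH _ (Dk v)) => x Ux.
have dkx := dk x Ux.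
rewrite [RHS]deriveE; last exact: differentiableZl.
by rewrite diffZl// deriveE.
Qed.

Lemma smooth_on_pair (F G : normedModType R) (f : E -> F) (g : E -> G) :
  smooth_on U f -> smooth_on U g -> smooth_on U (fun x => (f x, g x)).
Proof.
move=> sf sg n; move: f g {sf}(sf n) {sg}(sg n); elim: n => [|n IH] f g.
  by move=> cf cg x Ux; apply: cvg_pair; [exact: cf|exact: cg].
move=> [df Df] [dg Dg]; split=> [x Ux|v].
  by apply: differentiable_pair; [exact: df|exact: dg].
apply: Ck_eq (IH _ _ (Df v) (Dg v)) => x Ux.
have dfx := df x Ux; have dgx := dg x Ux.
rewrite [RHS]deriveE; last exact: differentiable_pair.
by rewrite diff_pair// !deriveE.
Qed.

Lemma smooth_on_fst (F G : normedModType R) (f : E -> F * G) :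
  smooth_on U f -> smooth_on U (fun x => (f x).1).
Proof.
by apply: (smooth_on_linear (L := (fst : {linear (F * G)%type -> F}))) => x;
  exact: cvg_fst.
Qed.

Lemma smooth_on_snd (F G : normedModType R) (f : E -> F * G) :
  smooth_on U f -> smooth_on U (fun x => (f x).2).
Proof.
by apply: (smooth_on_linear (L := (snd : {linear (F * G)%type -> G}))) => x;
  exact: cvg_snd.
Qed.

Lemma smooth_on_opp (F : normedModType R) (f : E -> F) :
  smooth_on U f -> smooth_on U (fun x => - f x).
Proof.
by apply: (smooth_on_linear (L := (-%R : {linear F -> F}))) => x;
  exact: continuousN.
Qed.

Lemma smooth_on_entry p q (f : E -> 'M[R]_(p, q)) i j :
  smooth_on U f -> smooth_on U (fun x => f x i j).
Proof.
have lin : linear (fun A : 'M[R]_(p, q) => A i j).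
  by move=> k A B; rewrite !mxE.
pose L : {linear 'M[R]_(p, q) -> R} :=
  HB.pack (fun A : 'M[R]_(p, q) => A i j) (GRing.isLinear.Build _ _ _ _ _ lin).
apply: (smooth_on_linear (L := L)); exact: coord_continuous.
Qed.

Lemma smooth_on_mulmx p q (f : E -> 'rV[R]_p) (g : E -> 'M[R]_(p, q)) :
  smooth_on U f -> smooth_on U g -> smooth_on U (fun x => f x *m g x).
Proof.
move=> sf sg.
apply: (smooth_on_eq (f := fun x =>
  \sum_(j < q) (\sum_(i < p) f x ord0 i * g x i j) *: (delta_mx ord0 j : 'rV[R]_q))).
  move=> x _; rewrite [RHS]row_sum_delta; apply: eq_bigr => j _.
  by rewrite mxE.
apply: smooth_on_sum => // j; apply: smooth_on_scale; apply: smooth_on_sum => // i.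
by apply: smooth_onM => //; exact: smooth_on_entry.
Qed.

End Ck.

(** * Symmetry of second derivatives *)

Lemma MVT_line (R : realType) (E : normedModType R) (f : E -> R) (x v : E)
    (h : R) : 0 < h ->
  (forall t : R, 0 <= t <= h -> differentiable f (x + t *: v)) ->
  exists2 t : R, 0 < t < h & f (x + h *: v) - f x = h * 'D_v f (x + t *: v).
Proof.
move=> h0 df.
pose l (t : R) : E := x + t *: v.
have dl t : is_diff t l ( *:%R^~ v).
  have := is_diffD (is_diff_cst x t) (is_diff_scalel t v).
  by rewrite add0r.
have dfl t : 0 <= t <= h -> differentiable (f \o l) t.
  by move=> th; apply: differentiable_comp; [exact: ex_diff|exact: df].
have [|t||c] := @MVT R (f \o l) (fun t => 'D_v f (l t)) 0 h => //.
- move=> /itvP th; have th' : 0 <= t <= h by rewrite !th.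
  split; first exact/diff_derivable/dfl.
  rewrite deriveE; last exact: dfl.
  rewrite diff_comp; [|exact: ex_diff|exact: df].
  by rewrite /= diff_val scale1r -deriveE//; exact: df.
- apply: continuous_in_subspaceT => t; rewrite inE/= in_itv/= => th.
  exact/differentiable_continuous/dfl.
- rewrite in_itv/= => ch fE; exists c => //.
  by move: fE; rewrite /l/= scale0r addr0 subr0 mulrC.
Qed.

(** The mean value theorem, first in the direction [v] for the function
    [q |-> f (q + h *: w) - f q], then in the direction [w] for ['D_v f].  As
    the left-hand side is symmetric in [v] and [w], exchanging them gives the
    other mixed derivative at another nearby point. *)
Lemma second_difference (R : realType) (E : normedModType R) (U : set E)
    (f : E -> R) (p v w : E) (h : R) : open U -> Ck 2 U f -> 0 < h ->
  (forall s t : R, 0 <= s <= h -> 0 <= t <= h -> U (p + s *: v + t *: w)) ->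
  exists s t : R, [/\ 0 < s < h, 0 < t < h &
    f (p + h *: v + h *: w) - f (p + h *: v) - (f (p + h *: w) - f p)
    = h * (h * 'D_w ('D_v f) (p + s *: v + t *: w))].
Proof.
move=> Uo [df Df] h0 hU.
have hh : 0 <= h <= h by rewrite lexx ltW.
have h00 : 0 <= (0 : R) <= h by rewrite lexx ltW.
have dshift (a q : E) : differentiable (fun q => q + a) q by [].
have dif t : 0 <= t <= h ->
    differentiable (fun q => f (q + h *: w) - f q) (p + t *: v).
  move=> th; apply: differentiableB; last first.
    by apply: df; rewrite -[_ + _]addr0 -(scale0r w); exact: hU.
  by apply: differentiable_comp => //; apply: df; exact: hU.
have [s sh ->] := MVT_line h0 dif.
have sh' : 0 <= s <= h by case/andP: sh => s0 s1; rewrite !ltW.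
have Us : U (p + s *: v).
  by rewrite -[_ + _]addr0 -(scale0r w); exact: hU.
have -> : 'D_v (fun q : E => f (q + h *: w) - f q) (p + s *: v) =
    'D_v f (p + s *: v + h *: w) - 'D_v f (p + s *: v).
  have d1 : derivable (fun q => f (q + h *: w)) (p + s *: v) v.
    apply: diff_derivable; apply: differentiable_comp => //.
    by apply: df; exact: hU.
  have d2 : derivable f (p + s *: v) v by apply: diff_derivable; exact: df.
  rewrite [LHS](deriveB d1 d2); congr (_ - _).
  by apply: derive_line; apply: filterE => k; rewrite !addrA.
have [t|t th ->] := @MVT_line _ _ ('D_v f) (p + s *: v) w h h0.
  by move=> th; have [D _] := Df v; apply: D; exact: hU.
by exists s, t; split => //; rewrite addrA.
Qed.

(** By [second_difference] in both orders, each mixed derivative takes at some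
    point the value of the other one at a second point, with both points
    arbitrarily close to [p], where the two derivatives are continuous. *)
Lemma derive_swap (R : realType) (E : normedModType R) (U : set E)
    (f : E -> R) (p v w : E) : open U -> Ck 2 U f -> U p ->
  'D_v ('D_w f) p = 'D_w ('D_v f) p.
Proof.
move=> Uo f2 Up; have [df Df] := f2.
have cvw v' w' : {for p, continuous ('D_v' ('D_w' f))}.
  by have [_ D] := Df w'; exact: (D v').
apply/eqP; rewrite -subr_eq0 -normr_le0.
apply/ler_addgt0Pr => e e0; rewrite add0r.
have e2 : 0 < e / 2 by rewrite divr_gt0.
have [r r0 hr] : exists2 r : R, 0 < r & forall q, `|q - p| < r ->
    [/\ U q, `|'D_v ('D_w f) q - 'D_v ('D_w f) p| < e / 2 &
      `|'D_w ('D_v f) q - 'D_w ('D_v f) p| < e / 2].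
  have : \forall q \near p, [/\ U q,
      `|'D_v ('D_w f) q - 'D_v ('D_w f) p| < e / 2 &
      `|'D_w ('D_v f) q - 'D_w ('D_v f) p| < e / 2].
    have A := open_nbhs_nbhs (conj Uo Up).
    have B : \forall q \near p, `|'D_v ('D_w f) q - 'D_v ('D_w f) p| < e / 2.
      by have /cvgrPdistC_lt := cvw v w; apply.
    have C : \forall q \near p, `|'D_w ('D_v f) q - 'D_w ('D_v f) p| < e / 2.
      by have /cvgrPdistC_lt := cvw w v; apply.
    by apply: filterS3 A B C => q ? ? ?; split.
  move=> /nbhs_normP [r /= r0 hr]; exists r => // q qr.
  by apply: hr; rewrite /= distrC.
(* This step [h] keeps the whole parallelogram in the ball of radius [r]. *)
pose N := 1 + `|v| + `|w|.
have N0 : 0 < N by rewrite /N -addrA ltr_pwDl// addr_ge0.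
pose h := r / 2 / N.
have h0 : 0 < h by rewrite /h !divr_gt0.
have hlt (s t : R) : 0 <= s <= h -> 0 <= t <= h ->
    `|p + s *: v + t *: w - p| < r.
  move=> /andP[s0 sh] /andP[t0 th].
  rewrite addrAC (addrAC p) subrr add0r (le_lt_trans (ler_normD _ _))// !normrZ.
  rewrite (ger0_norm s0) (ger0_norm t0).
  apply: (@le_lt_trans _ _ (h * N)); last first.
    by rewrite /h divfK ?gt_eqF// ltr_pdivrMr// ltr_pMr// ltr1n.
  have le1 : s * `|v| <= h * `|v| by apply: ler_wpM2r.
  have le2 : t * `|w| <= h * `|w| by apply: ler_wpM2r.
  by rewrite /N; lra.
have [s [t [/andP[s0 sh] /andP[t0 th] E1]]] :=
  second_difference Uo f2 h0 (fun s t hs ht => (let: And3 U' _ _ := hr _ (hlt s t hs ht) in U')).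
have hU' s' t' : 0 <= s' <= h -> 0 <= t' <= h -> U (p + s' *: w + t' *: v).
  by move=> hs ht; rewrite addrAC; case: (hr _ (hlt _ _ ht hs)).
have [s' [t' [/andP[s0' sh'] /andP[t0' th'] E2]]] := second_difference Uo f2 h0 hU'.
rewrite (addrAC p (h *: w)) (addrAC p (s' *: w)) in E2.
have [_ _ A1] := hr _ (hlt s t (introT andP (conj (ltW s0) (ltW sh)))
  (introT andP (conj (ltW t0) (ltW th)))).
have [_ A2 _] := hr _ (hlt t' s' (introT andP (conj (ltW t0') (ltW th')))
  (introT andP (conj (ltW s0') (ltW sh')))).
move: E1 E2 A1 A2.
move: ('D_w ('D_v f) (p + s *: v + t *: w)) => X.
move: ('D_v ('D_w f) (p + t' *: v + s' *: w)) => Y.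
move: ('D_v ('D_w f) p) ('D_w ('D_v f) p) => P Q.
move: (f p) (f (p + h *: v)) (f (p + h *: w)) (f (p + h *: v + h *: w)) => a b c d E1 E2.
have hn0 : h != 0 by rewrite gt_eqF.
have XY : X = Y.
  apply: (mulfI hn0); apply: (mulfI hn0); rewrite -E1 -E2; ring.
rewrite XY => A1 A2.
rewrite [leRHS]splitr -(subrKA Y) (le_trans (ler_normD _ _))// lerD// ltW//.
by rewrite distrC.
Qed.

(** * Algebra of pairs and projections *)

(** The projection is determined by its values on both summands, and it vanishes
    on [V] because the projections along [U] and [V] add up to the identity. *)
Lemma daddv_pi_decomp (K : fieldType) (vT : vectType K) (U V : {vspace vT})
    (x y : vT) : (U :&: V = 0)%VS -> x \in U -> y \in V ->
  daddv_pi U V (x + y) = x.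
Proof.
move=> UV xU yV; have VU : (V :&: U = 0)%VS by rewrite capvC.
have yUV : y \in (U + V)%VS by exact: subvP (addvSr U V) _ yV.
have := daddv_pi_add UV yUV; rewrite (daddv_pi_id VU yV) => /eqP.
rewrite -subr_eq0 addrK => /eqP y0.
by rewrite linearD /= y0 addr0 daddv_pi_id.
Qed.

Lemma sum_pair (V W : nmodType) (I : Type) (r : seq I) (f : I -> V)
    (g : I -> W) :
  \sum_(i <- r) (f i, g i) = (\sum_(i <- r) f i, \sum_(i <- r) g i).
Proof.
elim: r => [|i r IH]; first by rewrite !big_nil.
by rewrite !big_cons IH.
Qed.

Lemma scale_pair (K : pzRingType) (V W : lmodType K) (k : K) (x : V) (y : W) :
  k *: (x, y) = (k *: x, k *: y).
Proof. by []. Qed.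

Lemma add_pair (V W : nmodType) (x x' : V) (y y' : W) :
  (x, y) + (x', y') = (x + x', y + y').
Proof. by []. Qed.

Lemma opp_pair (V W : zmodType) (x : V) (y : W) : - (x, y) = (- x, - y).
Proof. by []. Qed.

Lemma row_pair_l (K : pzRingType) (V : lmodType K) (m : nat) (x : 'rV[K]_m) :
  (x, 0 : V) = \sum_(i < m) x ord0 i *: (delta_mx ord0 i : 'rV[K]_m, 0 : V).
Proof.
under eq_bigr => i _ do rewrite scale_pair scaler0.
by rewrite sum_pair big1_eq -row_sum_delta.
Qed.

Lemma row_pair_r (K : pzRingType) (V : lmodType K) (m : nat) (x : 'rV[K]_m) :
  (0 : V, x) = \sum_(i < m) x ord0 i *: (0 : V, delta_mx ord0 i : 'rV[K]_m).
Proof.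
under eq_bigr => i _ do rewrite scale_pair scaler0.
by rewrite sum_pair big1_eq -row_sum_delta.
Qed.


(** * Parallel almost Hermitian structures *)

Section ParallelKahler.
Context {R : realType} {E : normedModType R} {N : Type} (c : charts E N).
Context (J : N -> E -> E) (G : N -> E -> E -> R).
Context (D : (N -> E) -> (N -> E) -> N -> E).
Hypothesis hJ : almost_complex_structure c J.
Hypothesis hG : riemannian_metric c G.
Hypothesis hGJ : forall u w1 w2, G u (J u w1) (J u w2) = G u w1 w2.
Hypothesis D_torsion : forall X Y, smooth_field c X -> smooth_field c Y ->
  forall u, bracket c X Y u = D X Y u - D Y X u.
Hypothesis D_complex : forall X Y, smooth_field c X -> smooth_field c Y ->
  forall u, D X (field_map J Y) u = J u (D X Y u).
Hypothesis D_metric : forall X Y Z, smooth_field c X -> smooth_field c Y ->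
  smooth_field c Z -> forall u, lie_der c X (fun q => G q (Y q) (Z q)) u =
    G u (D X Y u) (Z u) + G u (Y u) (D X Z u).

(** Substituting [D X Y - D Y X] for each bracket and moving [J] out of [D] leaves
    the vectors [D X Y], [D Y X], [J (D (J X) Y)] and [J (D (J Y) X)], each of
    them twice with opposite signs. *)
Lemma nijenhuis_parallel X Y u : smooth_field c X -> smooth_field c Y ->
  nijenhuis c J X Y u = 0.
Proof.
move=> sX sY; have sJX := acs_smooth hJ sX; have sJY := acs_smooth hJ sY.
have JB v w : J u (v - w) = J u v - J u w := zmod_morphism_linear (acs_linear hJ u) v w.
rewrite /nijenhuis !D_torsion// !D_complex// !JB !(acs_square hJ).
move: (J u (D (field_map J X) Y u)) (J u (D (field_map J Y) X u)) => A B.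
move: (D X Y u) (D Y X u) => x y.
rewrite !opprB !opprK -[A - B + _ + _]addrA [B + x]addrC subrKA.
by rewrite [y + B]addrC subrKA [A + y]addrC -opprD addrN.
Qed.

Let om u w1 w2 := G u w1 (J u w2).

Lemma form_linear u k w1 w2 w : om u (k *: w1 + w2) w = k * om u w1 w + om u w2 w.
Proof. exact: (riem_linear hG). Qed.

(** Apply the isometry [J] to both arguments, then [J ^ 2 = -1] and the symmetry
    of [G]. *)
Lemma form_skew u w1 w2 : om u w1 w2 = - om u w2 w1.
Proof.
have GN w w' : G u (- w) w' = - G u w w'.
  have := riem_linear hG u (-1) w 0 w'; rewrite scaleN1r addr0 => ->.
  have := riem_linear hG u 1 0 0 w'; rewrite scale1r addr0 mul1r; lra.
by rewrite /om (riem_sym hG) -hGJ (acs_square hJ) GN.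
Qed.

Lemma formB u w1 w2 w : om u (w1 - w2) w = om u w1 w - om u w2 w.
Proof.
have := form_linear u (-1) w2 w1 w; rewrite scaleN1r addrC => ->; lra.
Qed.

Lemma lie_der_form X Y Z u : smooth_field c X -> smooth_field c Y ->
  smooth_field c Z -> lie_der c X (fundamental_form J G Y Z) u =
  om u (D X Y u) (Z u) - om u (D X Z u) (Y u).
Proof.
move=> sX sY sZ; have sJZ := acs_smooth hJ sZ.
rewrite -form_skew.
by rewrite (D_metric sX sY sJZ) D_complex.
Qed.

(** By [lie_der_form] each derivative of the form contributes two values of it,
    and torsion-freeness splits each bracket into two more; skew-symmetry makes
    these twelve terms cancel. *)
Lemma dform2_parallel X Y Z u : smooth_field c X -> smooth_field c Y ->
  smooth_field c Z -> dform2 c (fundamental_form J G) X Y Z u = 0.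
Proof.
move=> sX sY sZ; rewrite /dform2 !lie_der_form// /fundamental_form !D_torsion//.
rewrite -!/(om _ _ _) !formB; ring.
Qed.

(** The vanishing of the torsion is what links the parallelism of [J] and [G] to
    brackets of fields, hence to the Nijenhuis tensor and to the exterior
    derivative, neither of which involves [D]. *)
Lemma kahler_of_parallel : is_kahler c J G.
Proof.
split=> //.
- by move=> X Y sX sY u; exact: nijenhuis_parallel.
- by move=> X Y Z sX sY sZ u; exact: dform2_parallel.
Qed.

End ParallelKahler.


(** * Differentiable atlases *)

(** What the calculus of [to_chart] and [from_chart] needs of an atlas.  It
    mentions no topology on [N], so that it applies both to the charts of the
    base and to the induced charts of the slit tangent bundle, whose topology is
    the one that these charts generate. *)
Record differentiable_atlas (R : realType) (E : normedModType R) (N : Type)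
    (c : charts E N) : Prop := {
  atlas_open : forall a b : cidx c, open (phi a @` (dom a `&` dom b)) ;
  atlas_phiK : forall (a : cidx c) p, dom a p -> psi a (phi a p) = p ;
  atlas_diff : forall (a b : cidx c) p, dom a p -> dom b p ->
    differentiable (phi b \o psi a) (phi a p) ;
  atlas_chart_at : forall p, dom (chart_at c p) p
}.

Section Linear.
Context {R : realType} {E : normedModType R} {N : Type} (c : charts E N).
Variables (a : cidx c) (u : N).

Lemma to_chart_linear : linear (to_chart a u).
Proof. by move=> k v w; rewrite /to_chart linearP. Qed.
HB.instance Definition _ :=
  GRing.isLinear.Build R E E *:%R (to_chart a u) to_chart_linear.

Lemma from_chart_linear : linear (from_chart a u).
Proof. by move=> k v w; rewrite /from_chart linearP. Qed.
HB.instance Definition _ :=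
  GRing.isLinear.Build R E E *:%R (from_chart a u) from_chart_linear.

End Linear.

Section Atlas.
Context {R : realType} {E : normedModType R} {N : Type} (c : charts E N).
Hypothesis hc : differentiable_atlas c.
Implicit Types (a b e : cidx c) (u : N) (w : E).

Lemma overlap_nbhs a b u : dom a u -> dom b u ->
  \forall z \near phi a u, (phi a @` (dom a `&` dom b)) z.
Proof.
by move=> da db; apply: open_nbhs_nbhs; split; [exact: atlas_open|exists u].
Qed.

Lemma diff_transition_id a u w : dom a u -> 'd (phi a \o psi a) (phi a u) w = w.
Proof.
move=> da; have id_near : {near phi a u, phi a \o psi a =1 id}.
  apply: filterS (overlap_nbhs da da) => z [v [dv _] <-] /=.
  by rewrite (atlas_phiK hc).
by rewrite (near_eq_diff id_near) ?diff_val //; exact: (atlas_diff hc).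
Qed.

(** The chain rule: near [phi a u] the change of charts from [a] to [b] factors
    through the chart [e]. *)
Lemma diff_transition_comp a e b u w : dom a u -> dom e u -> dom b u ->
  'd (phi b \o psi e) (phi e u) ('d (phi e \o psi a) (phi a u) w) =
  'd (phi b \o psi a) (phi a u) w.
Proof.
move=> da de db.
have near_comp : {near phi a u, (phi b \o psi e) \o (phi e \o psi a) =1 phi b \o psi a}.
  apply: filterS (overlap_nbhs da de) => z [v [dv dve] <-] /=.
  by rewrite !(atlas_phiK hc).
have ea : (phi e \o psi a) (phi a u) = phi e u by rewrite /= (atlas_phiK hc).
have d1 := atlas_diff hc da de.
have d2 : differentiable (phi b \o psi e) ((phi e \o psi a) (phi a u)).
  by rewrite ea; exact: (atlas_diff hc).
rewrite -(near_eq_diff near_comp); last exact: differentiable_comp.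
by rewrite diff_comp //= (atlas_phiK hc).
Qed.

Lemma to_from_chart a b u w : dom a u -> dom b u ->
  to_chart b u (from_chart a u w) = 'd (phi b \o psi a) (phi a u) w.
Proof.
by move=> da db; rewrite /to_chart /from_chart diff_transition_comp//;
  exact: atlas_chart_at.
Qed.

Lemma diff_to_chart a b u w : dom a u -> dom b u ->
  'd (phi b \o psi a) (phi a u) (to_chart a u w) = to_chart b u w.
Proof.
by move=> da db; rewrite /to_chart diff_transition_comp//; exact: atlas_chart_at.
Qed.

Lemma from_chartK a u : dom a u -> cancel (from_chart a u) (to_chart a u).
Proof. by move=> da w; rewrite to_from_chart// diff_transition_id. Qed.

Lemma to_chartK a u : dom a u -> cancel (to_chart a u) (from_chart a u).
Proof.
move=> da w; have de := atlas_chart_at hc u.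
by rewrite /to_chart /from_chart diff_transition_comp// diff_transition_id.
Qed.

Lemma to_chart_at u w : to_chart (chart_at c u) u w = w.
Proof. by rewrite /to_chart diff_transition_id//; exact: atlas_chart_at. Qed.

End Atlas.

Section BaseManifold.
Context {R : realType} {E : normedModType R} {M : topologicalType}.
Context {c : charts E M} (hM : is_smooth_manifold c).

(** Openness of [phi a @` (dom a `&` dom b)]: near a point of [target a] the map
    [psi a] is continuous, so it keeps its values in the open set [dom b]. *)
Lemma manifold_atlas : differentiable_atlas c.
Proof.
have op (a b : cidx c) : open (phi a @` (dom a `&` dom b)).
  rewrite openE => z [p [da db] <-].
  have ta : target a (phi a p) by exists p.
  have cont : {for phi a p, continuous (psi a)}.
    have := mfd_psi_continuous hM (a := a).
    rewrite continuous_open_subspace; last exact: mfd_target_open.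
    by apply; rewrite inE.
  have nb : \forall z \near phi a p, dom b (psi a z).
    apply: cont; rewrite (mfd_phiK hM da).
    by apply: open_nbhs_nbhs; split; [exact: (mfd_dom_open hM)|].
  have nt : \forall z \near phi a p, target a z.
    by apply: open_nbhs_nbhs; split; [exact: (mfd_target_open hM)|].
  apply: filterS2 nb nt => y dby [q dq qy]; exists q => //; split=> //.
  by move: dby; rewrite -qy (mfd_phiK hM dq).
split.
- exact: op.
- exact: mfd_phiK.
- move=> a b p da db; apply: smooth_on_differentiable (mfd_transition hM a b) _.
  by exists p.
- exact: mfd_chart_at.
Qed.

End BaseManifold.

(** * The induced charts on the slit tangent bundle *)

Lemma fst_differentiable (R : realType) (E F : normedModType R) (z : E * F) :
  differentiable (fst : E * F -> E) z.
Proof.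
by apply: (@linear_differentiable _ _ _ (fst : {linear (E * F)%type -> E})) => x;
  exact: cvg_fst.
Qed.

Lemma snd_differentiable (R : realType) (E F : normedModType R) (z : E * F) :
  differentiable (snd : E * F -> F) z.
Proof.
by apply: (@linear_differentiable _ _ _ (snd : {linear (E * F)%type -> F})) => x;
  exact: cvg_snd.
Qed.

Lemma diff_fst (R : realType) (E F : normedModType R) (z w : E * F) :
  'd (fst : E * F -> E) z w = w.1.
Proof.
by rewrite (@diff_lin _ _ _ (fst : {linear (E * F)%type -> E}))// => x;
  exact: cvg_fst.
Qed.

Lemma diff_fst_comp (R : realType) (D E F : normedModType R) (g : D -> E * F)
    (x w : D) : differentiable g x -> 'd (fst \o g) x w = ('d g x w).1.
Proof.
move=> dg; rewrite diff_comp//=; last exact: fst_differentiable.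
exact: diff_fst.
Qed.

(** Expressing the differential through partial derivatives turns its dependence
    on the base point into the smoothness of finitely many functions. *)
Lemma diff_rowE (R : realType) (m : nat) (F : normedModType R)
    (f : 'rV[R]_m -> F) (x v : 'rV[R]_m) : differentiable f x ->
  'd f x v = \sum_(i < m) v ord0 i *: 'D_(delta_mx ord0 i) f x.
Proof.
move=> df; rewrite {1}(row_sum_delta v) linear_sum /=.
by apply: eq_bigr => i _; rewrite linearZ /= deriveE.
Qed.

Lemma differentiable_sum_pt (R : realType) (E F : normedModType R) n
    (f : 'I_n -> E -> F) x : (forall i, differentiable (f i) x) ->
  differentiable (fun y => \sum_(i < n) f i y) x.
Proof.
move=> df; rewrite -[X in differentiable X _]fct_sumE.
exact: differentiable_sum.
Qed.

Lemma differentiable_tangent (R : realType) (m : nat)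
    (f : 'rV[R]_m -> 'rV[R]_m) (U : set 'rV[R]_m) (z : 'rV[R]_m * 'rV[R]_m) :
  open U -> smooth_on U f -> U z.1 ->
  differentiable (fun z : 'rV[R]_m * 'rV[R]_m => (f z.1, 'd f (z.1) z.2)) z.
Proof.
move=> Uo sf Uz.
have d1 := fst_differentiable z; have d2 := snd_differentiable z.
apply: differentiable_pair.
  apply: (differentiable_comp d1).
  exact: smooth_on_differentiable sf Uz.
have nU : \forall y \near z, U y.1.
  by apply: (cvg_fst (F := nbhs z.1) (G := nbhs z.2)); apply: open_nbhs_nbhs.
pose g (y : 'rV[R]_m * 'rV[R]_m) := \sum_(i < m) \sum_(j < m)
  (y.2 ord0 i * 'D_(delta_mx ord0 i) f (y.1) ord0 j) *: delta_mx ord0 j : 'rV[R]_m.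
have fE : {near z, g =1 (fun y : 'rV[R]_m * 'rV[R]_m => 'd f (y.1) y.2)}.
  apply: filterS nU => y Uy /=; rewrite diff_rowE//; last first.
    exact: smooth_on_differentiable sf Uy.
  apply: eq_bigr => i _; rewrite [in RHS](row_sum_delta ('D_(delta_mx ord0 i) f _)).
  by rewrite scaler_sumr; apply: eq_bigr => j _; rewrite scalerA.
apply: near_eq_differentiable fE _.
apply: differentiable_sum_pt => i; apply: differentiable_sum_pt => j.
apply: differentiableZl; apply: differentiableM.
  exact: (differentiable_comp d2 (differentiable_coord (snd z) ord0 i)).
apply: (differentiable_comp d1 (g := fun x => 'D_(delta_mx ord0 i) f x ord0 j)).
have dD : differentiable ('D_(delta_mx ord0 i) f) (z.1).
  exact: smooth_on_differentiable (smooth_on_derive _ sf) Uz.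
exact: (differentiable_comp dD (differentiable_coord _ ord0 j)).
Qed.

Section SlitCharts.
Context {R : realType} {m : nat} {M : topologicalType}.
Context {c : charts 'rV[R]_m M} (hM : is_smooth_manifold c).
Context {M' : set (M * 'rV[R]_m)%type} (u0 : M') (hM' : slit_domain c M').

Local Notation E := 'rV[R]_m.
Local Notation EE := ('rV[R]_m * 'rV[R]_m)%type.
Local Notation c' := (slit_charts c u0).
Local Notation hc := (manifold_atlas hM).
Implicit Types (a b : cidx c') (u : M') (w : EE) (xi eta : E).

(** The Jacobian, at the base point of [u], of the change of base coordinates
    from [a] to [b]. *)
Definition base_diff a b u : E -> E :=
  'd (phi (b : cidx c) \o psi (a : cidx c)) (phi (a : cidx c) (tpi u)).

Lemma slit_phiK a u : dom a u -> psi a (phi a u) = u.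
Proof.
move=> da; rewrite /= (atlas_phiK hc)//.
by rewrite (to_chartK hc)// -surjective_pairing valKd.
Qed.

Lemma slit_chart_at u : dom (chart_at c' u) u.
Proof. exact: (atlas_chart_at hc). Qed.

Lemma slit_target_open a : open (target a).
Proof.
have sO : chart_open (tangent_charts c) M' by exact: slit_open hM'.
have := sO (a : cidx (tangent_charts c)).
congr open; apply/seteqP; split=> z /=.
  by case=> q [Mq da] <-; exists (SigSub (mem_set Mq)).
by case=> u da <-; exists (val u) => //; split => //; exact: set_valP.
Qed.

Lemma slit_overlap a b : phi a @` (dom a `&` dom b) =
  target a `&` fst @^-1` (phi (a : cidx c) @` (dom (a : cidx c) `&` dom (b : cidx c))).
Proof.
apply/seteqP; split=> z /=.
  by case=> u [da db] <-; split; [exists u|exists (tpi u)].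
case=> -[u da <-] [p [dap dbp]] /= pE; exists u => //; split=> //.
have pu : p = tpi u by rewrite -[LHS](atlas_phiK hc dap) pE (atlas_phiK hc da).
by change (dom (b : cidx c) (tpi u)); rewrite -pu.
Qed.

Lemma slit_overlap_open a b : open (phi a @` (dom a `&` dom b)).
Proof.
rewrite slit_overlap; apply: openI; first exact: slit_target_open.
apply: open_comp; last exact: (atlas_open hc).
by move=> z _; exact: cvg_fst.
Qed.

(** The second component holds because [phi b] and [phi a] record the same
    tangent vector of the base in two charts, related by [diff_to_chart]. *)
Lemma slit_transitionE a b z : (phi a @` (dom a `&` dom b)) z ->
  (phi b \o psi a) z =
  (phi (b : cidx c) (psi (a : cidx c) (z.1)),
   'd (phi (b : cidx c) \o psi (a : cidx c)) (z.1) z.2).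
Proof.
case=> u [da db] <-; have /= -> := slit_phiK da.
rewrite /= (atlas_phiK hc)//; congr pair.
exact/esym/(diff_to_chart hc).
Qed.

Lemma slit_transition_near a b u : dom a u -> dom b u ->
  {near phi a u, (fun z : EE => (phi (b : cidx c) (psi (a : cidx c) (z.1)),
   'd (phi (b : cidx c) \o psi (a : cidx c)) (z.1) z.2)) =1 phi b \o psi a}.
Proof.
move=> da db; apply: filterS (_ : \forall z \near phi a u, (phi a @` (dom a `&` dom b)) z).
  by move=> z hz; rewrite slit_transitionE.
by apply: open_nbhs_nbhs; split; [exact: slit_overlap_open|exists u].
Qed.

Lemma slit_atlas : differentiable_atlas c'.
Proof.
split; [exact: slit_overlap_open|exact: slit_phiK| |exact: slit_chart_at].
move=> a b u da db; apply: near_eq_differentiable (slit_transition_near da db) _.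
have := @differentiable_tangent R m (phi (b : cidx c) \o psi (a : cidx c)) _ (phi a u)
  (atlas_open hc a b) (mfd_transition hM a b); apply.
by exists (tpi u).
Qed.

(** The base coordinates of [phi b] depend on those of [phi a] alone. *)
Lemma slit_diff_fst a b u w : dom a u -> dom b u ->
  ('d (phi b \o psi a) (phi a u) w).1 = base_diff a b u w.1.
Proof.
move=> da db; have dt := atlas_diff slit_atlas da db.
have df : differentiable (phi (b : cidx c) \o psi (a : cidx c)) (phi (a : cidx c) (tpi u)).
  exact: (atlas_diff hc).
have d1 := fst_differentiable (phi a u).
rewrite -diff_fst_comp//.
have nE : {near phi a u, fst \o (phi b \o psi a) =1
    (phi (b : cidx c) \o psi (a : cidx c)) \o fst}.
  apply: filterS (slit_transition_near da db) => z zE.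
  exact: (esym (congr1 fst zE)).
rewrite (near_eq_diff nE); last first.
  exact: (differentiable_comp dt (fst_differentiable _)).
rewrite diff_comp//=.
by rewrite diff_fst.
Qed.

(** Along a fibre the base point is fixed and the change of coordinates is the
    linear map [base_diff a b u]. *)
Lemma slit_transition_vert a b u eta : dom a u -> dom b u ->
  \forall h \near (0 : R), (phi b \o psi a) (h *: (0, eta) + phi a u) =
    h *: (0, base_diff a b u eta) + phi b u.
Proof.
move=> da db.
have cont := @line_cvg R EE (phi a u) (0, eta).
have nr := slit_transition_near da db.
pose g z : EE := (phi (b : cidx c) (psi (a : cidx c) (z.1)),
   'd (phi (b : cidx c) \o psi (a : cidx c)) (z.1) z.2).
have nr' : \forall h \near (0 : R),
  (phi b \o psi a) (h *: (0, eta) + phi a u) = g (h *: (0, eta) + phi a u).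
  by near=> h; apply/esym; near: h; exact: (cont _ nr).
have gE h : g (h *: (0, eta) + phi a u) = h *: (0, base_diff a b u eta) + phi b u.
  have h1 : (h *: (0, eta) + phi a u).1 = phi (a : cidx c) (tpi u).
    by rewrite /= scaler0 add0r.
  rewrite /g h1 (atlas_phiK hc)//; congr pair; first by rewrite /= scaler0 add0r.
  rewrite linearD linearZ; congr (_ + _); exact: (diff_to_chart hc).
near=> h; rewrite -gE; near: h; exact: nr'.
Unshelve. all: by end_near.
Qed.

Lemma slit_diff_vert a b u eta : dom a u -> dom b u ->
  'd (phi b \o psi a) (phi a u) (0, eta) = (0, base_diff a b u eta).
Proof.
move=> da db; rewrite -deriveE; last exact: (atlas_diff slit_atlas).
rewrite (@derive_line _ _ _ _ _ (@id EE) _ _ (phi b u) (0, base_diff a b u eta)).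
  by rewrite derive_id.
exact: slit_transition_vert.
Qed.

(** In the chart used to encode tangent vectors at [u], the bundle projection is
    [fst]. *)
Lemma mem_VM u w : (w \in VM c u0 u) = (w.1 == 0).
Proof.
rewrite memv_ker /tangent_map lfunE /=.
set e := chart_at c _.
have nE : {near phi (e : cidx c') u, fst =1 phi e \o tpi (M' := M') \o psi (e : cidx c')}.
  apply: filterS (overlap_nbhs slit_atlas (slit_chart_at u) (slit_chart_at u)).
  move=> z [v [dv _] <-].
  exact: (esym (congr1 (fun q => phi (e : cidx c) (tpi q)) (slit_phiK dv))).
by rewrite -(near_eq_diff nE) ?diff_fst//; exact: fst_differentiable.
Qed.

End SlitCharts.

(** * The horizontal splitting and its almost complex structure *)

Section Splitting.
Context {R : realType} {m : nat} {M : topologicalType}.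
Context {c : charts 'rV[R]_m M} (hM : is_smooth_manifold c).
Context {M' : set (M * 'rV[R]_m)%type} (u0 : M') (hM' : slit_domain c M').
Context (H : M' -> {vspace ('rV[R]_m * 'rV[R]_m)%type}).
Hypothesis hH : nonlinear_connection c u0 H.

Local Notation E := 'rV[R]_m.
Local Notation EE := ('rV[R]_m * 'rV[R]_m)%type.
Local Notation c' := (slit_charts c u0).
Local Notation hc' := (slit_atlas hM u0 hM').
Local Notation hv := (hproj c u0 H).
Local Notation vv := (vproj c u0 H).
Local Notation J := (assocJ c u0 H).
Implicit Types (a b : cidx c') (u : M') (w : EE) (xi eta : E) (X : M' -> EE).

Lemma base_diff_linear a b u : linear (base_diff a b u).
Proof. by move=> k x y; rewrite /base_diff linearP. Qed.
HB.instance Definition _ a b u :=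
  GRing.isLinear.Build R E E *:%R (base_diff a b u) (base_diff_linear a b u).

Lemma to_chart_fst a b u w : dom a u -> dom b u ->
  (to_chart b u w).1 = base_diff a b u (to_chart a u w).1.
Proof.
move=> da db; rewrite -(diff_to_chart hc' w da db).
exact: (slit_diff_fst hM hM').
Qed.

Lemma to_chart_vert a b u w eta : dom a u -> dom b u ->
  to_chart a u w = (0, eta) -> to_chart b u w = (0, base_diff a b u eta).
Proof.
move=> da db E1; rewrite -(diff_to_chart hc' w da db) E1.
exact: (slit_diff_vert hM hM').
Qed.

Lemma mem_VM_chart a u w : dom a u ->
  (w \in VM c u0 u) = ((to_chart a u w).1 == 0).
Proof.
move=> da; have de := slit_chart_at hM u0 u.
rewrite (mem_VM hM u0 hM'); apply/eqP/eqP => w0.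
  by rewrite (to_chart_fst w de da) (to_chart_at hc' u w) w0 linear0.
by rewrite -(to_chart_at hc' u w) (to_chart_fst w da de) w0 linear0.
Qed.

Lemma vertical_chart a u w : dom a u -> w \in VM c u0 u ->
  to_chart a u w = (0, (to_chart a u w).2).
Proof.
move=> da; rewrite (mem_VM_chart _ da) => /eqP.
by case: (to_chart a u w) => x y /= ->.
Qed.

Lemma vert_lift a u eta : dom a u -> from_chart a u (0, eta) \in VM c u0 u.
Proof. by move=> da; rewrite (mem_VM_chart _ da) (from_chartK hc' da). Qed.

Lemma hvK u w : hv u w + vv u w = w.
Proof. by rewrite daddv_pi_add ?(nlc_direct hH)// (nlc_full hH) memvf. Qed.

Lemma vv_mem u w : vv u w \in VM c u0 u. Proof. exact: memv_pi. Qed.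

Lemma hv_decomp u x y : x \in H u -> y \in VM c u0 u -> hv u (x + y) = x.
Proof. by apply: daddv_pi_decomp; exact: (nlc_direct hH). Qed.

Lemma vv_decomp u x y : x \in H u -> y \in VM c u0 u -> vv u (x + y) = y.
Proof.
by move=> xH yV; rewrite addrC; apply: daddv_pi_decomp => //;
  rewrite capvC; exact: (nlc_direct hH).
Qed.

Lemma vv_id u w : w \in VM c u0 u -> vv u w = w.
Proof. by move=> wV; rewrite -[in LHS](add0r w) vv_decomp// mem0v. Qed.

Lemma hv_vert u w : w \in VM c u0 u -> hv u w = 0.
Proof. by move=> wV; rewrite -[in LHS](add0r w) hv_decomp// mem0v. Qed.

(** Stated through the horizontal lifts [(xi, - xi N)] of all vectors [xi] of the
    base rather than through a spanning family, which is the form in which the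
    splitting of a vector is read off. *)
Definition connection_coefficients a (Nc : EE -> 'M[R]_m) : Prop :=
  smooth_on (target a) Nc /\ forall u, dom a u -> forall xi : E,
    from_chart a u (xi, - (xi *m Nc (phi a u))) \in H u.

Lemma connection_coefficients_exist a : exists Nc, connection_coefficients a Nc.
Proof.
have [Nc [sN HN]] := nlc_smooth hH a; exists Nc; split=> // u da xi.
rewrite (HN u da).
have -> : from_chart a u (xi, - (xi *m Nc (phi a u))) = \sum_(i < m)
    xi ord0 i *: (pd_x a u i - \sum_(j < m) Nc (phi a u) i j *: pd_y a u j).
  have -> : (xi, - (xi *m Nc (phi a u))) = (xi, 0) - (0, xi *m Nc (phi a u)) :> EE.
    by rewrite opp_pair add_pair oppr0 addr0 add0r.
  rewrite linearB/= row_pair_l linear_sum/= mulmx_sum_row.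
  under [RHS]eq_bigr => i _ do rewrite scalerBr.
  rewrite sumrB; congr (_ - _); first by apply: eq_bigr => i _; rewrite linearZ.
  have -> : (0, \sum_i xi ord0 i *: row i (Nc (phi a u))) =
      \sum_i xi ord0 i *: (0, row i (Nc (phi a u))) :> EE.
    under [RHS]eq_bigr => i _ do rewrite scale_pair scaler0.
    by rewrite sum_pair big1_eq.
  rewrite linear_sum; apply: eq_bigr => i _; rewrite linearZ; congr (_ *: _).
  rewrite row_pair_r linear_sum; apply: eq_bigr => j _.
  by rewrite linearZ mxE.
apply: rpred_sum => i _; apply: rpredZ; apply: memv_span.
by apply/mapP; exists i => //; rewrite mem_enum.
Qed.

Section Chart.
Variables (a : cidx c') (Nc : EE -> 'M[R]_m) (hN : connection_coefficients a Nc).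
Variables (u : M') (da : dom a u).
Local Notation P := (to_chart a u).
Local Notation Q := (from_chart a u).
Local Notation N := (Nc (phi a u)).

(** The two right-hand sides are horizontal and vertical and add up to [w]. *)
Lemma hv_vv_chart w : hv u w = Q ((P w).1, - ((P w).1 *m N)) /\
  vv u w = Q (0, (P w).2 + (P w).1 *m N).
Proof.
have wE : w = Q ((P w).1, - ((P w).1 *m N)) + Q (0, (P w).2 + (P w).1 *m N).
  rewrite -[LHS](to_chartK hc' da) -linearD; congr (Q _).
  by rewrite {1}[P w]surjective_pairing add_pair addr0 addrC addrK.
have hm := hN.2 u da (P w).1; have vm := vert_lift ((P w).2 + (P w).1 *m N) da.
by split; rewrite [in LHS]wE; [exact: hv_decomp|exact: vv_decomp].
Qed.

(** Compare with the preferred chart [e] at [u], where this is the definition of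
    [J].  Vertical lifts transform by the Jacobian [B] of the base; so do the
    lifts [(eta, 0)] up to a vertical vector, which [hv] kills; and the
    components that are lifted transform by [B] too. *)
Lemma assocJ_chart_lift w :
  J u w = hv u (Q ((P (vv u w)).2, 0)) - Q (0, (P w).1).
Proof.
have de := slit_chart_at hM u0 u; pose e := chart_at c' u.
have vE := vertical_chart de (vv_mem u w).
have aE : P (vv u w) = (0, base_diff e a u (to_chart e u (vv u w)).2).
  by apply: to_chart_vert de da vE.
have JE : J u w = hv u (from_chart e u ((to_chart e u (vv u w)).2, 0)) -
                  from_chart e u (0, (to_chart e u w).1).
  rewrite /assocJ /delta_y /delta_x /d_x /d_y /pd_x /pd_y sumrB.
  rewrite (row_pair_l _ (to_chart e u (vv u w)).2) (row_pair_r _ (to_chart e u w).1).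
  congr (_ - _); rewrite !linear_sum; apply: eq_bigr => i _; by rewrite !linearZ.
set eta := (to_chart e u (vv u w)).2 in JE aE.
have p1 : hv u (from_chart e u (eta, 0)) = hv u (Q ((P (vv u w)).2, 0)).
  rewrite aE; apply/eqP; rewrite -subr_eq0 -linearB; apply/eqP/hv_vert.
  rewrite (mem_VM_chart _ da) linearB /= (from_chartK hc' da (base_diff e a u eta, 0)) /=.
  have e1 := to_chart_fst (from_chart e u (eta, 0)) de da.
  by rewrite e1 (from_chartK hc' de (eta, 0)) subrr.
have p2 : from_chart e u (0, (to_chart e u w).1) = Q (0, (P w).1).
  apply: (can_inj (to_chartK hc' da)).
  have e1 := to_chart_vert de da (from_chartK hc' de (0, (to_chart e u w).1)).
  have e2 := congr1 (pair (0 : E)) (to_chart_fst w de da).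
  exact: (etrans e1 (etrans (esym e2) (esym (from_chartK hc' da (0, (P w).1))))).
exact: (etrans JE (congr2 (fun x y => x - y) p1 p2)).
Qed.

Lemma hv_chart w : P (hv u w) = ((P w).1, - ((P w).1 *m N)).
Proof. by rewrite (hv_vv_chart w).1 (from_chartK hc' da). Qed.

Lemma vv_chart w : P (vv u w) = (0, (P w).2 + (P w).1 *m N).
Proof. by rewrite (hv_vv_chart w).2 (from_chartK hc' da). Qed.

(** The coordinate expression of [J]; it makes the algebraic identities below
    matrix computations, and it shows that [J] is smooth. *)
Lemma assocJ_chart w :
  P (J u w) = ((P w).2 + (P w).1 *m N,
               - (P w).1 - ((P w).2 + (P w).1 *m N) *m N).
Proof.
rewrite assocJ_chart_lift linearB /= hv_chart !(from_chartK hc' da) vv_chart /=.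
by rewrite opp_pair add_pair oppr0 addr0 addrC.
Qed.

Lemma chart_inj w1 w2 : P w1 = P w2 -> w1 = w2.
Proof. exact: (can_inj (to_chartK hc' da)). Qed.

End Chart.

Lemma chart_with_coefficients u : exists (e : cidx c') (Nc : EE -> 'M[R]_m),
  connection_coefficients e Nc /\ dom e u.
Proof.
have [Nc hN] := connection_coefficients_exist (chart_at c' u).
by exists (chart_at c' u), Nc; split => //; exact: slit_chart_at.
Qed.

Lemma assocJ_linear u (k : R) w1 w2 :
  J u (k *: w1 + w2) = k *: J u w1 + J u w2.
Proof.
have [e [Nc [hN de]]] := chart_with_coefficients u.
apply: (chart_inj de); rewrite linearP /= !(assocJ_chart hN de) linearP /=.
case: (to_chart e u w1) (to_chart e u w2) => [x1 y1] [x2 y2] /=.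
set N := Nc _; rewrite !scale_pair !add_pair.
have zE : k *: y1 + y2 + (k *: x1 + x2) *m N =
    k *: (y1 + x1 *m N) + (y2 + x2 *m N).
  by rewrite mulmxDl -scalemxAl scalerDr addrACA.
rewrite zE; congr pair.
by rewrite mulmxDl -scalemxAl scalerBr scalerN !opprD addrACA.
Qed.

Lemma assocJB u w1 w2 : J u (w1 - w2) = J u w1 - J u w2.
Proof. exact: (zmod_morphism_linear (assocJ_linear u)). Qed.

Lemma assocJ0 u : J u 0 = 0.
Proof. by rewrite -[in LHS](subrr (0 : EE)) assocJB subrr. Qed.

Lemma assocJN u w : J u (- w) = - J u w.
Proof. by rewrite -[in LHS](sub0r w) assocJB assocJ0 sub0r. Qed.

Lemma assocJ_square u w : J u (J u w) = - w.
Proof.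
have [e [Nc [hN de]]] := chart_with_coefficients u.
apply: (chart_inj de); rewrite linearN /= !(assocJ_chart hN de) /=.
case: (to_chart e u w) => [x y] /=; rewrite opp_pair subrK; congr pair.
by rewrite mulNmx opprK opprD subrK.
Qed.

Lemma vv_assocJ u w : vv u (J u w) = J u (hv u w).
Proof.
have [e [Nc [hN de]]] := chart_with_coefficients u.
apply: (chart_inj de).
rewrite (vv_chart hN de) !(assocJ_chart hN de) (hv_chart hN de) /=.
by rewrite subrK addNr mul0mx subr0.
Qed.

Lemma hv_assocJ u w : hv u (J u w) = J u (vv u w).
Proof.
have [e [Nc [hN de]]] := chart_with_coefficients u.
apply: (chart_inj de).
rewrite (hv_chart hN de) !(assocJ_chart hN de) (vv_chart hN de) /=.
by rewrite mul0mx addr0 oppr0 add0r.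
Qed.

Lemma Jh_vert u w : J u (hv u w) \in VM c u0 u.
Proof. by rewrite -vv_assocJ vv_mem. Qed.

Lemma JhJ u w : J u (hv u (J u w)) = - vv u w.
Proof. by rewrite hv_assocJ assocJ_square. Qed.

Lemma to_chart_Jh a Nc u w : connection_coefficients a Nc -> dom a u ->
  to_chart a u (J u (hv u w)) = (0, - (to_chart a u w).1).
Proof.
move=> hN da; rewrite (assocJ_chart hN da) (hv_chart hN da) /=.
by rewrite addNr mul0mx subr0.
Qed.

End Splitting.

Section Fields.
Context {R : realType} {m : nat} {M : topologicalType}.
Context {c : charts 'rV[R]_m M} (hM : is_smooth_manifold c).
Context {M' : set (M * 'rV[R]_m)%type} (u0 : M') (hM' : slit_domain c M').
Context (H : M' -> {vspace ('rV[R]_m * 'rV[R]_m)%type}).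
Hypothesis hH : nonlinear_connection c u0 H.

Local Notation E := 'rV[R]_m.
Local Notation EE := ('rV[R]_m * 'rV[R]_m)%type.
Local Notation c' := (slit_charts c u0).
Local Notation hc' := (slit_atlas hM u0 hM').
Local Notation hv := (hproj c u0 H).
Local Notation vv := (vproj c u0 H).
Local Notation J := (assocJ c u0 H).
Implicit Types (a b : cidx c') (u : M') (w : EE) (xi eta : E) (X : M' -> EE).

Lemma chart_repE a u X : dom a u -> chart_rep a X (phi a u) = to_chart a u (X u).
Proof.
by move=> da; exact: (congr1 (fun q => to_chart a q (X q)) (slit_phiK hM da)).
Qed.

(** Components are computed as functions of a point of the chart, whereas
    [smooth_field] reads them through the inverse chart. *)
Lemma smooth_field_chart X (g : cidx c' -> EE -> EE) :
  (forall a, smooth_on (target a) (g a)) ->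
  (forall a u, dom a u -> to_chart a u (X u) = g a (phi a u)) ->
  smooth_field c' X.
Proof.
move=> sg Xg a; apply: smooth_on_eq (sg a); first exact: slit_target_open.
by move=> z [u da <-]; rewrite chart_repE// Xg.
Qed.

Let Nc a := projT1 (cid (connection_coefficients_exist hH a)).
Let hN a : connection_coefficients H a (Nc a) := projT2 (cid (connection_coefficients_exist hH a)).

Lemma smooth_vfield X : smooth_field c' X -> smooth_field c' (vfield c u0 H X).
Proof.
move=> sX; apply: (smooth_field_chart (g := fun a z => (0,
    (chart_rep a X z).2 + (chart_rep a X z).1 *m Nc a z))).
  move=> a; have tO : open (target a) by exact: slit_target_open.
  have [s1 s2] := (smooth_on_fst tO (sX a), smooth_on_snd tO (sX a)).
  apply: smooth_on_pair => //; first exact: smooth_on_cst.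
  by apply: smooth_onD => //; apply: smooth_on_mulmx => //; exact: (hN a).1.
move=> a u da; rewrite chart_repE//.
exact: (vv_chart hM hM' hH (hN a) da).
Qed.

Lemma smooth_Jfield X : smooth_field c' X -> smooth_field c' (field_map J X).
Proof.
move=> sX; pose z1 a z := (chart_rep a X z).2 + (chart_rep a X z).1 *m Nc a z.
apply: (smooth_field_chart (g := fun a z => (z1 a z,
    - (chart_rep a X z).1 - z1 a z *m Nc a z))).
  move=> a; have tO : open (target a) by exact: slit_target_open.
  have [s1 s2] := (smooth_on_fst tO (sX a), smooth_on_snd tO (sX a)).
  have sz : smooth_on (target a) (z1 a).
    by apply: smooth_onD => //; apply: smooth_on_mulmx => //; exact: (hN a).1.
  apply: smooth_on_pair => //; apply: smooth_onD => //; first exact: smooth_on_opp.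
  apply: smooth_on_opp => //; apply: smooth_on_mulmx => //; exact: (hN a).1.
move=> a u da; rewrite /z1 chart_repE//.
exact: (assocJ_chart hM hM' hH (hN a) da).
Qed.

Lemma smooth_Jhfield X : smooth_field c' X ->
  smooth_field c' (field_map J (hfield c u0 H X)).
Proof.
move=> sX; apply: (smooth_field_chart (g := fun a z => (0, - (chart_rep a X z).1))).
  move=> a; have tO : open (target a) by exact: slit_target_open.
  apply: smooth_on_pair => //; first exact: smooth_on_cst.
  by apply: smooth_on_opp => //; exact: smooth_on_fst.
move=> a u da; rewrite chart_repE//.
exact: (to_chart_Jh hM hM' hH (X u) (hN a) da).
Qed.

Lemma vfield_section X : smooth_field c' X ->
  vertical_section c u0 (vfield c u0 H X).
Proof. by move=> sX; split; [exact: smooth_vfield|move=> u; exact: vv_mem]. Qed.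

Lemma Jhfield_section X : smooth_field c' X ->
  vertical_section c u0 (field_map J (hfield c u0 H X)).
Proof.
by move=> sX; split; [exact: smooth_Jhfield|move=> u; exact: (Jh_vert hM hM' hH)].
Qed.

Lemma smooth_fun_chart (f : M' -> R) (g : cidx c' -> EE -> R) :
  (forall a, smooth_on (target a) (g a)) ->
  (forall a u, dom a u -> f u = g a (phi a u)) -> smooth_fun c' f.
Proof.
move=> sg fg a; apply: smooth_on_eq (sg a); first exact: slit_target_open.
move=> z [u da <-]; rewrite -fg//.
exact: (esym (congr1 f (slit_phiK hM da))).
Qed.

Lemma lie_derD X (f g : M' -> R) u : smooth_fun c' f -> smooth_fun c' g ->
  lie_der c' X (fun q => f q + g q) u = lie_der c' X f u + lie_der c' X g u.
Proof.
move=> sf sg; pose e := chart_at c' u.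
have tu : target e (phi e u) by exists u => //; exact: slit_chart_at.
have df := smooth_on_differentiable (sf e) tu.
have dg := smooth_on_differentiable (sg e) tu.
exact: (congr1 (fun k => k (X u)) (diffD df dg)).
Qed.

End Fields.

(** * The Sasaki metric *)

Section Metric.
Context {R : realType} {m : nat} {M : topologicalType}.
Context {c : charts 'rV[R]_m M} (hM : is_smooth_manifold c).
Context {M' : set (M * 'rV[R]_m)%type} (u0 : M') (hM' : slit_domain c M').
Context (F : M' -> R) (hF : finsler c u0 F).

Local Notation E := 'rV[R]_m.
Local Notation EE := ('rV[R]_m * 'rV[R]_m)%type.
Local Notation c' := (slit_charts c u0).
Local Notation hc' := (slit_atlas hM u0 hM').
Implicit Types (a b : cidx c') (u : M') (w : EE) (xi eta : E) (X : M' -> EE).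

Definition energy a : EE -> R := (fun q => F q ^+ 2) \o psi a.

(** The fundamental tensor as a bilinear form on fibre directions: its matrix is
    [gF F a u]. *)
Definition fibre_hessian a u xi eta : R :=
  2^-1 * 'D_((0, xi) : EE) ('D_((0, eta) : EE) (energy a)) (phi a u).

Lemma energy_smooth a : smooth_on (target a) (energy a).
Proof.
have tO : open (target a) by exact: slit_target_open.
have sF : smooth_on (target a) (F \o psi a) by exact: (finsler_smooth hF).
apply: (smooth_on_eq tO) (smooth_onM tO sF sF) => z _.
by rewrite /energy /= expr2.
Qed.

Lemma target_phi a u : dom a u -> target a (phi a u).
Proof. by move=> da; exists u. Qed.

Lemma fibre_hessianC a u xi eta : dom a u ->
  fibre_hessian a u xi eta = fibre_hessian a u eta xi.
Proof.
move=> da; have tO : open (target a) by exact: slit_target_open.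
have swap := derive_swap (0, xi) (0, eta) tO ((@energy_smooth a) 2%N) (target_phi da).
exact: (congr1 (fun r => 2^-1 * r) swap).
Qed.

Lemma fibre_hessian_sumr a u xi eta : dom a u -> fibre_hessian a u xi eta =
  \sum_(i < m) xi ord0 i * fibre_hessian a u (delta_mx ord0 i) eta.
Proof.
move=> da; rewrite /fibre_hessian.
have tO : open (target a) by exact: slit_target_open.
set g := 'D_((0, eta) : EE) (energy a).
have sg : smooth_on (target a) g by apply: smooth_on_derive; exact: energy_smooth.
have dg := smooth_on_differentiable sg (target_phi da).
rewrite deriveE// row_pair_r linear_sum mulr_sumr.
apply: eq_bigr => i _; rewrite linearZ /= deriveE//.
by rewrite mulrCA.
Qed.

Lemma fibre_hessianE a u xi eta : dom a u -> fibre_hessian a u xi eta =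
  \sum_(i < m) \sum_(j < m) gF F a u i j * xi ord0 i * eta ord0 j.
Proof.
move=> da; rewrite fibre_hessian_sumr//; apply: eq_bigr => i _.
rewrite fibre_hessianC// fibre_hessian_sumr// mulr_sumr; apply: eq_bigr => j _.
rewrite fibre_hessianC// -[gF _ _ _ _ _]/(fibre_hessian a u _ _).
by rewrite mulrA mulrC mulrA.
Qed.

(** A short line segment along the fibre direction [eta] stays in the overlap of
    the two charts; read in the chart [b] it is again a segment of a line, and
    the base point, hence the Jacobian, is constant along it. *)
Lemma vert_line a b u eta : dom a u -> dom b u ->
  \forall h \near (0 : R), exists v, [/\ dom a v, dom b v,
    phi a v = h *: (0, eta) + phi a u,
    phi b v = h *: (0, base_diff a b u eta) + phi b u &
    forall xi, base_diff a b v xi = base_diff a b u xi].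
Proof.
move=> da db.
have cont := @line_cvg R EE (phi a u) (0, eta).
have nO := overlap_nbhs hc' da db.
have n1 : \forall h \near (0 : R),
    (phi a @` (dom a `&` dom b)) (h *: (0, eta) + phi a u).
  exact: (cont _ nO).
apply: filterS2 n1 (slit_transition_vert hM hM' eta da db) => h [v [dva dvb] vE] hE.
have vb : phi b v = (phi b \o psi a) (phi a v).
  exact: (esym (congr1 (phi b) (slit_phiK hM dva))).
have {}vb := etrans vb (etrans (congr1 (phi b \o psi a) vE) hE).
exists v; split; [exact: dva|exact: dvb|exact: vE|exact: vb|].
move=> xi; have E1 : phi (a : cidx c) (tpi v) = phi (a : cidx c) (tpi u).
  by have := congr1 fst vE; rewrite /= scaler0 add0r.
by rewrite /base_diff E1.
Qed.

Lemma fibre_derive_change a b u eta : dom a u -> dom b u ->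
  'D_((0, eta) : EE) (energy a) (phi a u) =
  'D_((0, base_diff a b u eta) : EE) (energy b) (phi b u).
Proof.
move=> da db; apply: derive_line.
apply: filterS (vert_line eta da db) => h [v [dva dvb <- <- _]].
rewrite /energy /=.
exact: (congr1 (fun q => F q ^+ 2)
  (etrans (slit_phiK hM dva) (esym (slit_phiK hM dvb)))).
Qed.

(** The energy does not depend on the chart and coordinate changes are linear along
    fibres, so by [derive_line] both derivatives transform by the Jacobian; no
    derivative of the Jacobian appears because it is constant along the fibre. *)
Lemma fibre_hessian_change a b u xi eta : dom a u -> dom b u ->
  fibre_hessian a u xi eta =
  fibre_hessian b u (base_diff a b u xi) (base_diff a b u eta).
Proof.
move=> da db; rewrite /fibre_hessian; apply: (congr1 (fun r => 2^-1 * r)).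
apply: derive_line; apply: filterS (vert_line xi da db) => h [v [dva dvb <- <- Bv]].
apply: (etrans (fibre_derive_change eta dva dvb)).
exact: (congr1 (fun x => 'D_((0, x) : EE) (energy b) (phi b v)) (Bv eta)).
Qed.

Lemma gV_hessian u w1 w2 : gV c u0 F u w1 w2 =
  fibre_hessian (chart_at c' u) u (to_chart (chart_at c' u) u w1).2
    (to_chart (chart_at c' u) u w2).2.
Proof. exact: esym (fibre_hessianE _ _ (slit_chart_at hM u0 u)). Qed.

(** The definition of [gV] uses the fibre components in the preferred chart; these
    are tensorial on vertical vectors only, whence the hypotheses. *)
Lemma gV_chart a u w1 w2 : dom a u -> w1 \in VM c u0 u -> w2 \in VM c u0 u ->
  gV c u0 F u w1 w2 = fibre_hessian a u (to_chart a u w1).2 (to_chart a u w2).2.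
Proof.
move=> da v1 v2; have de := slit_chart_at hM u0 u.
have e1 := congr1 snd (to_chart_vert hM hM' de da (vertical_chart hM hM' de v1)).
have e2 := congr1 snd (to_chart_vert hM hM' de da (vertical_chart hM hM' de v2)).
have ch := fibre_hessian_change (to_chart (chart_at c' u) u w1).2
  (to_chart (chart_at c' u) u w2).2 de da.
apply: (etrans (gV_hessian u w1 w2)); apply: (etrans ch).
exact: (esym (congr2 (fibre_hessian a u) e1 e2)).
Qed.

Lemma gV_linear u (k : R) w1 w2 w :
  gV c u0 F u (k *: w1 + w2) w = k * gV c u0 F u w1 w + gV c u0 F u w2 w.
Proof.
rewrite /gV mulr_sumr -big_split; apply: eq_bigr => i _ /=.
rewrite mulr_sumr -big_split; apply: eq_bigr => j _ /=.
rewrite /d_y linearP /= !mxE; ring.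
Qed.

Lemma gV_sym u w1 w2 : gV c u0 F u w1 w2 = gV c u0 F u w2 w1.
Proof.
by rewrite !gV_hessian (fibre_hessianC _ _ (slit_chart_at hM u0 u)).
Qed.

Lemma gV0 u w : gV c u0 F u 0 w = 0.
Proof. by have := gV_linear u 1 0 0 w; rewrite scale1r addr0 mul1r; lra. Qed.

Lemma gVNN u w1 w2 : gV c u0 F u (- w1) (- w2) = gV c u0 F u w1 w2.
Proof.
have gN x y : gV c u0 F u (- x) y = - gV c u0 F u x y.
  by have := gV_linear u (-1) x 0 y; rewrite scaleN1r addr0 gV0 mulN1r addr0.
by rewrite gN gV_sym gN opprK gV_sym.
Qed.

Lemma gV_pos u w : w \in VM c u0 u -> w != 0 -> 0 < gV c u0 F u w w.
Proof.
move=> wV w0; have de := slit_chart_at hM u0 u.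
apply: (finsler_convex hF de); apply: contraNneq w0 => y0.
rewrite -(to_chart_at hc' u w) (vertical_chart hM hM' de wV); apply/eqP.
by congr pair.
Qed.

Lemma gV_smooth U W : vertical_section c u0 U -> vertical_section c u0 W ->
  smooth_fun c' (fun u => gV c u0 F u (U u) (W u)).
Proof.
move=> [sU vU] [sW vW].
apply: (smooth_fun_chart hM hM' (g := fun a z => \sum_(i < m) \sum_(j < m)
  2^-1 * 'D_((0, delta_mx ord0 i) : EE) ('D_((0, delta_mx ord0 j) : EE) (energy a)) z
   * (chart_rep a U z).2 ord0 i * (chart_rep a W z).2 ord0 j)).
  move=> a; have tO : open (target a) by exact: slit_target_open.
  apply: smooth_on_sum => // i; apply: smooth_on_sum => // j.
  apply: smooth_onM => //; last first.
    by apply: smooth_on_entry => //; apply: smooth_on_snd => //; exact: sW.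
  apply: smooth_onM => //; last first.
    by apply: smooth_on_entry => //; apply: smooth_on_snd => //; exact: sU.
  apply: smooth_onM => //; first exact: smooth_on_cst.
  do 2!apply: smooth_on_derive; exact: energy_smooth.
move=> a u da; apply: (etrans (gV_chart da (vU u) (vW u))).
rewrite (chart_repE hM U da) (chart_repE hM W da).
exact: fibre_hessianE.
Qed.

End Metric.

Section Sasaki.
Context {R : realType} {m : nat} {M : topologicalType}.
Context {c : charts 'rV[R]_m M} (hM : is_smooth_manifold c).
Context {M' : set (M * 'rV[R]_m)%type} (u0 : M') (hM' : slit_domain c M').
Context (F : M' -> R) (hF : finsler c u0 F).
Context (H : M' -> {vspace ('rV[R]_m * 'rV[R]_m)%type}).
Hypothesis hH : nonlinear_connection c u0 H.

Local Notation E := 'rV[R]_m.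
Local Notation EE := ('rV[R]_m * 'rV[R]_m)%type.
Local Notation c' := (slit_charts c u0).
Local Notation hc' := (slit_atlas hM u0 hM').
Local Notation hv := (hproj c u0 H).
Local Notation vv := (vproj c u0 H).
Local Notation J := (assocJ c u0 H).
Local Notation G := (sasaki c u0 H F).
Local Notation g := (gV c u0 F).
Implicit Types (a b : cidx c') (u : M') (w : EE) (xi eta : E) (X : M' -> EE).

(** The vertical field [J h w] carries the base components of [w], up to a sign that
    the bilinear form does not see. *)
Lemma sasakiE u w1 w2 : G u w1 w2 =
  g u (vv u w1) (vv u w2) + g u (J u (hv u w1)) (J u (hv u w2)).
Proof.
have de := slit_chart_at hM u0 u.
have [Nc hN] := connection_coefficients_exist hH (chart_at c' u).
rewrite /gV -big_split; apply: eq_bigr => i _ /=.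
rewrite -big_split; apply: eq_bigr => j _ /=.
rewrite /delta_y /d_x /d_y.
have e1 := to_chart_Jh hM hM' hH w1 hN de.
have e2 := to_chart_Jh hM hM' hH w2 hN de.
have -> : (to_chart (chart_at c' u) u (J u (hv u w1))).2 = - (to_chart (chart_at c' u) u w1).1.
  exact: (congr1 snd e1).
have -> : (to_chart (chart_at c' u) u (J u (hv u w2))).2 = - (to_chart (chart_at c' u) u w2).1.
  exact: (congr1 snd e2).
rewrite !mxE; ring.
Qed.

(** [J] exchanges the two vertical vectors [v w] and [J h w], up to sign. *)
Lemma sasaki_hermitian u w1 w2 : G u (J u w1) (J u w2) = G u w1 w2.
Proof.
rewrite (sasakiE u (J u w1) (J u w2)) (sasakiE u w1 w2).
rewrite (vv_assocJ hM hM' hH u w1) (vv_assocJ hM hM' hH u w2).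
rewrite (JhJ hM hM' hH u w1) (JhJ hM hM' hH u w2).
by rewrite (gVNN hM hM' hF u (vv u w1) (vv u w2)) addrC.
Qed.

Lemma sasaki_metric : riemannian_metric c' G.
Proof.
split.
- move=> u k w1 w2 w.
  rewrite (sasakiE u (k *: w1 + w2) w) (sasakiE u w1 w) (sasakiE u w2 w).
  rewrite (linearP (vv u)) (linearP (hv u)).
  rewrite (assocJ_linear hM hM' hH u k (hv u w1) (hv u w2)).
  by rewrite 2!(gV_linear u0 F u k) mulrDr addrACA.
- move=> u w1 w2; rewrite (sasakiE u w1 w2) (sasakiE u w2 w1).
  by rewrite (gV_sym hM hM' hF u (vv u w1)) (gV_sym hM hM' hF u (J u (hv u w1))).
- move=> u w w0; rewrite sasakiE.
  have gge0 x : x \in VM c u0 u -> 0 <= g u x x.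
    move=> xV; have [->|x0] := eqVneq x 0; first by rewrite gV0.
    exact/ltW/(gV_pos hM hM' hF).
  have vV := vv_mem u0 H u w.
  have JV := Jh_vert hM hM' hH u w.
  have [v0|v0] := eqVneq (vv u w) 0; last first.
    by rewrite ltr_pwDl ?gge0// (gV_pos hM hM' hF).
  rewrite ltr_wpDl ?gge0// (gV_pos hM hM' hF)//.
  apply: contraNneq w0 => J0.
  have h0 : hv u w = 0.
    have := assocJ_square hM hM' hH u (hv u w); rewrite J0.
    by rewrite (assocJ0 hM hM' hH) => /esym/eqP; rewrite oppr_eq0 => /eqP.
  by rewrite -(hvK hH u w) h0 v0 addr0.
- move=> X Y sX sY a.
  have s1 := gV_smooth hM hM' hF (vfield_section hM hM' hH sX) (vfield_section hM hM' hH sY).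
  have s2 := gV_smooth hM hM' hF (Jhfield_section hM hM' hH sX) (Jhfield_section hM hM' hH sY).
  have tO : open (target a) by exact: slit_target_open.
  apply: (smooth_on_eq tO) (smooth_onD tO (s1 a) (s2 a)) => z _.
  by rewrite /= sasakiE.
Qed.

End Sasaki.

(** * The natural connection *)

Section NaturalConnection.
Context {R : realType} {m : nat} {M : topologicalType}.
Context {c : charts 'rV[R]_m M} (hM : is_smooth_manifold c).
Context {M' : set (M * 'rV[R]_m)%type} (u0 : M') (hM' : slit_domain c M').
Context (F : M' -> R) (hF : finsler c u0 F).
Context (H : M' -> {vspace ('rV[R]_m * 'rV[R]_m)%type}).
Hypothesis hH : nonlinear_connection c u0 H.

Local Notation E := 'rV[R]_m.
Local Notation EE := ('rV[R]_m * 'rV[R]_m)%type.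
Local Notation c' := (slit_charts c u0).
Local Notation hc' := (slit_atlas hM u0 hM').
Local Notation hv := (hproj c u0 H).
Local Notation vv := (vproj c u0 H).
Local Notation J := (assocJ c u0 H).
Local Notation G := (sasaki c u0 H F).
Local Notation g := (gV c u0 F).
Implicit Types (a b : cidx c') (u : M') (w : EE) (xi eta : E) (X : M' -> EE).

Context (nabla : (M' -> EE) -> (M' -> EE) -> M' -> EE).
Hypothesis hn : linear_connection c u0 nabla.
Hypothesis nabla_metric : forall X U W, smooth_field c' X ->
    vertical_section c u0 U -> vertical_section c u0 W ->
    forall u, lie_der c' X (fun q => g q (U q) (W q)) u =
              g u (nabla X U u) (W u) + g u (U u) (nabla X W u).
Local Notation D := (natural_connection c u0 H nabla).

Lemma assocJ_acs : almost_complex_structure c' J.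
Proof.
split; first exact: (assocJ_linear hM hM' hH).
  exact: (assocJ_square hM hM' hH).
by move=> X; exact: (smooth_Jfield hM hM' hH).
Qed.

Lemma vertical_section0 : vertical_section c u0 (fun=> 0).
Proof.
split=> [|u]; last exact: mem0v.
apply: (smooth_field_chart hM hM' (g := fun _ _ => 0)).
  by move=> a; apply: smooth_on_cst; exact: slit_target_open.
by move=> a u _; rewrite linear0.
Qed.

(** Additivity gives [nabla X 0 = 0], hence the value at the opposite section. *)
Lemma nablaN X U V u : smooth_field c' X -> vertical_section c u0 U ->
  vertical_section c u0 V -> (forall q, V q = - U q) ->
  nabla X V u = - nabla X U u.
Proof.
move=> sX sU sV VE.
have n0 : nabla X (fun=> 0) u = 0.
  have := lc_additive hn sX vertical_section0 vertical_section0 u.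
  have -> : (fun _ : M' => 0 + 0 : EE) = (fun=> 0) by apply/funext => q; rewrite addr0.
  by move=> /eqP; rewrite eq_sym -subr_eq0 addrK => /eqP.
have := lc_additive hn sX sV sU u.
have -> : (fun q => V q + U q) = (fun=> 0).
  by apply/funext => q; rewrite VE addNr.
by rewrite n0 => /esym/eqP; rewrite addr_eq0 => /eqP.
Qed.

(** [J Y] has the vertical parts [v (J Y) = J h Y] and [J h (J Y) = - v Y]. *)
Lemma natural_complex X Y u : smooth_field c' X -> smooth_field c' Y ->
  D X (field_map J Y) u = J u (D X Y u).
Proof.
move=> sX sY; have sJY := smooth_Jfield hM hM' hH sY.
have v1 : vfield c u0 H (field_map J Y) = field_map J (hfield c u0 H Y).
  by apply/funext => q; exact: (vv_assocJ hM hM' hH).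
rewrite /natural_connection v1.
have sV := vfield_section hM hM' hH sY.
have sW := Jhfield_section hM hM' hH sJY.
have nN := nablaN u sX sV sW (fun q => JhJ hM hM' hH q (Y q)).
rewrite nN (assocJN hM hM' hH) opprK (assocJB hM hM' hH) (assocJ_square hM hM' hH).
by rewrite opprK addrC.
Qed.

Lemma vv_natural X Y u : smooth_field c' X -> smooth_field c' Y ->
  vv u (D X Y u) = nabla X (vfield c u0 H Y) u.
Proof.
move=> sX sY; have sV := vfield_section hM hM' hH sY.
have sW := Jhfield_section hM hM' hH sY.
have A := (lc_section hn sX sV).2 u.
have B := (lc_section hn sX sW).2 u.
rewrite /natural_connection linearB /= (vv_id hH A).
rewrite (vv_assocJ hM hM' hH) (hv_vert hH B) (assocJ0 hM hM' hH).
by rewrite subr0.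
Qed.

Lemma Jhv_natural X Y u : smooth_field c' X -> smooth_field c' Y ->
  J u (hv u (D X Y u)) = nabla X (field_map J (hfield c u0 H Y)) u.
Proof.
move=> sX sY; have sV := vfield_section hM hM' hH sY.
have sW := Jhfield_section hM hM' hH sY.
have A := (lc_section hn sX sV).2 u.
have B := (lc_section hn sX sW).2 u.
rewrite /natural_connection linearB /= (hv_vert hH A) sub0r.
rewrite (assocJN hM hM' hH) (JhJ hM hM' hH) opprK.
exact: (vv_id hH B).
Qed.

(** By [vv_natural] and [Jhv_natural], [D X] acts as [nabla X] on the two vertical
    fields [v Y] and [J h Y], in terms of which [sasakiE] expresses [G]. *)
Lemma natural_metric X Y Z u : smooth_field c' X -> smooth_field c' Y ->
  smooth_field c' Z ->
  lie_der c' X (fun q => G q (Y q) (Z q)) u =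
  G u (D X Y u) (Z u) + G u (Y u) (D X Z u).
Proof.
move=> sX sY sZ.
have [vY vZ] := (vfield_section hM hM' hH sY, vfield_section hM hM' hH sZ).
have [wY wZ] := (Jhfield_section hM hM' hH sY, Jhfield_section hM hM' hH sZ).
have -> : (fun q => G q (Y q) (Z q)) = (fun q =>
    g q (vfield c u0 H Y q) (vfield c u0 H Z q) +
    g q (field_map J (hfield c u0 H Y) q) (field_map J (hfield c u0 H Z) q)).
  by apply/funext => q; exact: (sasakiE hM hM' F hH).
rewrite (lie_derD hM X u (gV_smooth hM hM' hF vY vZ) (gV_smooth hM hM' hF wY wZ)).
rewrite (nabla_metric sX vY vZ u) (nabla_metric sX wY wZ u).
have eY := congr2 (fun w w' => g u w (vv u (Z u)) + g u w' (J u (hv u (Z u))))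
  (vv_natural u sX sY) (Jhv_natural u sX sY).
have eZ := congr2 (fun w w' => g u (vv u (Y u)) w + g u (J u (hv u (Y u))) w')
  (vv_natural u sX sZ) (Jhv_natural u sX sZ).
have eYZ := congr2 +%R (etrans (sasakiE hM hM' F hH u (D X Y u) (Z u)) eY)
  (etrans (sasakiE hM hM' F hH u (Y u) (D X Z u)) eZ).
by apply: etrans (esym eYZ); exact: addrACA.
Qed.

End NaturalConnection.

Theorem corollary2 (R : realType) (m : nat) (M : topologicalType)
    (c : charts 'rV[R]_m M) (hM : is_smooth_manifold c)
    (M' : set (M * 'rV[R]_m)%type) (u0 : M') (hM' : slit_domain c M')
    (F : M' -> R) (hF : finsler c u0 F)
    (H : M' -> {vspace ('rV[R]_m * 'rV[R]_m)%type})
    (hH : nonlinear_connection c u0 H)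
    (S T : (M' -> ('rV[R]_m * 'rV[R]_m)%type) ->
           (M' -> ('rV[R]_m * 'rV[R]_m)%type) ->
           M' -> ('rV[R]_m * 'rV[R]_m)%type)
    (hS : skew_finsler_tensor c u0 S) (hT : skew_finsler_tensor c u0 T)
    (nabla : (M' -> ('rV[R]_m * 'rV[R]_m)%type) ->
             (M' -> ('rV[R]_m * 'rV[R]_m)%type) ->
             M' -> ('rV[R]_m * 'rV[R]_m)%type)
    (hFC : cartan_connection c u0 F H S T nabla)
    (htorsion : forall X Y : M' -> ('rV[R]_m * 'rV[R]_m)%type,
       smooth_field (slit_charts c u0) X -> smooth_field (slit_charts c u0) Y ->
       forall u, torsion c u0 (natural_connection c u0 H nabla) X Y u = 0) :
  is_kahler (slit_charts c u0) (assocJ c u0 H) (sasaki c u0 H F).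
Proof.
have hn := cc_linear hFC.
apply: (kahler_of_parallel (D := natural_connection c u0 H nabla)).
- exact: (assocJ_acs hM hM' hH).
- exact: (sasaki_metric hM hM' hF hH).
- exact: (sasaki_hermitian hM hM' hF hH).
- move=> X Y sX sY u; apply/esym/eqP; rewrite -subr_eq0; apply/eqP.
  exact: htorsion.
- by move=> X Y sX sY u; exact: (natural_complex hM hM' hH hn).
- move=> X Y Z sX sY sZ u.
  by apply: (natural_metric hM hM' hF hH hn) => //; exact: (cc_metric hFC).
Qed.
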